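(* Let $M,N$ be finite-dimensional von Neumann algebras with faithful positive functionals $\varphi_M,\varphi_N$, acting on $L^2(M)$ and $L^2(N)$, and let $\theta\colon N\to M$ be a $*$-homomorphism. Write $N=\bigoplus_\alpha\mathbb M_{n(\alpha)}$, let $1_\alpha$ be the unit of $\mathbb M_{n(\alpha)}$, let $(e^\alpha_{i,j})$ be the matrix units of $\mathbb M_{n(\alpha)}$, and let $Q_{N,\alpha}\in\mathbb M_{n(\alpha)}$ be the component of $Q_N$. For each $\alpha$ identify $\mathrm{Im}\,\theta(1_\alpha)\subseteq L^2(M)$ with $\mathbb C^{n(\alpha)}\otimes K_\alpha$, for a finite-dimensional Hilbert space $K_\alpha$, in such a way that $\theta(x)$ restricted to $\mathrm{Im}\,\theta(1_\alpha)$ is $x\otimes1$ for $x\in\mathbb M_{n(\alpha)}$. Write $$\theta(1_\alpha)Q_M^{-1/2}\theta(1_\alpha)=\sum_{i,j}e^\alpha_{i,j}\otimes t^\alpha_{i,j}\in\mathbb M_{n(\alpha)}\otimes\mathcal B(K_\alpha),\qquad v_\alpha=\sum_{i,j}(Q_{N,\alpha}^{-1/2})_{j,i}\,t^\alpha_{i,j}\in\mathcal B(K_\alpha).$$ Then each $v_\alpha$ is positive and invertible, and $1\otimes v_\alpha$ is the restriction to $\mathrm{Im}\,\theta(1_\alpha)$ of an element of $M$. Put $u_\alpha=v_\alpha^{-1}$ and $u=\sum_\alpha\theta(1_\alpha)(1\otimes u_\alpha)\theta(1_\alpha)$. Then $u$ is a positive element of $M\cap\theta(N)'$, whose restriction to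 $\mathrm{Im}\,\theta(1_\alpha)$ is the invertible operator $1\otimes u_\alpha$ for each $\alpha$, and the map $$A\colon N\to M,\qquad A(x)=Q_M^{-1/4}u^{1/2}\,\theta(Q_N^{1/4}xQ_N^{1/4})\,u^{1/2}Q_M^{-1/4}$$ is the quantum adjacency operator associated to $(V^\theta)^*$: it is completely positive, Schur idempotent, and $$M'\nabla_M^{1/4}A\nabla_N^{-1/4}N'=(V^{\theta})^*.$$
   Context: For a finite-dimensional von Neumann algebra $M$ with faithful positive functional $\varphi_M$, let $L^2(M)$ be the GNS space with GNS map $\Lambda_M\colon M\to L^2(M)$ (a linear bijection); $M$ acts on $L^2(M)$ by left multiplication, and $M'$ is its commutant in $\mathcal B(L^2(M))$. Linear maps $A\colon N\to M$ are identified with operators in $\mathcal B(L^2(N),L^2(M))$ via $A\Lambda_N(x)=\Lambda_M(A(x))$. The Markov trace $\mathrm{Tr}_M$ is the restriction to $M$ of the canonical trace on $\mathcal B(L^2(M))$; on $N=\bigoplus_\alpha\mathbb M_{n(\alpha)}$ it is $\mathrm{Tr}_N(x)=\sum_\alpha n(\alpha)\mathrm{Tr}(1_\alpha x)$ with $\mathrm{Tr}$ the non-normalised trace. $Q_M\in M$ is the positive invertible element with $\varphi_M(x)=\mathrm{Tr}_M(Q_Mx)$, and $\nabla_M\Lambda_M(x)=\Lambda_M(Q_MxQ_M^{-1})$; similarly for $N$. With $m_M\colon L^2(M)\otimes L^2(M)\to L^2(M)$ the multiplication map, and $m_N^*$ the Hilbert space adjoint of $m_N$, the Schur product of $A,B\colon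 N\to M$ is $A\star B=m_M(A\otimes B)m_N^*$, and $A$ is Schur idempotent when $A\star A=A$. $V^\theta=\{v\in\mathcal B(L^2(M),L^2(N)):yv=v\theta(y)\ (y\in N)\}$, and $(V^\theta)^*=\{v^*:v\in V^\theta\}$. $M'XN'$ denotes the linear span of $\{a'Xb':a'\in M',b'\in N'\}$. $\theta(N)'$ denotes the commutant of $\theta(N)$ in $\mathcal B(L^2(M))$. $\theta$ is not assumed unital.
   Formalization: The formula u_α = v_α^{-1} is corrected to u_α = n(α) v_α^{-1}: with the Markov trace normalisation the literal A is not Schur idempotent, e.g. for M = N = M_n (n ≥ 2), θ = id, φ = Tr_M, where A = id/n but A⋆A = id/n². *)

(* Defs.v *)
(* Definitions are over a numClosedFieldType C; the complex numbers are the
   instance R[i] with R : realType. *)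
From HB Require Import structures.
From mathcomp Require Import all_boot all_order all_algebra.
From mathcomp Require Import boolp classical_sets reals.
From mathcomp.real_closed Require Import complex mxtens.

Set Implicit Arguments.
Unset Strict Implicit.
Unset Printing Implicit Defensive.

Import Order.TTheory GRing.Theory Num.Theory.
Local Open Scope ring_scope.

(** * Positive matrices *)

Section Matrices.
Variable C : numClosedFieldType.

Definition adjmx m n (A : 'M[C]_(m, n)) : 'M[C]_(n, m) := map_mx Num.conj A^T.

Definition dotcv n (xi eta : 'cV[C]_n) : C := (adjmx xi *m eta) 0 0.

(* On C the relation [0 <= z] says that z is real and nonnegative, so
   hermitian symmetry is part of this definition. *)
Definition psdmx n (A : 'M[C]_n) : Prop :=
  forall xi : 'cV[C]_n, 0 <= dotcv xi (A *m xi).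

End Matrices.

(* The positive k-th root, for a notion of positivity [pos]; it is the unique
   element of the set below whenever [a] is positive and [0 < k]. *)
Definition posroot (A : pzRingType) (pos : A -> Prop) (k : nat) (a : A) : A :=
  xget 0 [set b : A | pos b /\ b ^+ k = a]%classic.

Definition invertible (A : pzRingType) (a : A) : Prop :=
  exists b, a * b = 1 /\ b * a = 1.

(* The two-sided inverse (MathComp's unit rings exclude the zero ring). *)
Definition ringinv (A : pzRingType) (a : A) : A :=
  xget 0 [set b : A | a * b = 1 /\ b * a = 1]%classic.

(** * Finite-dimensional von Neumann algebras *)

(* A unital *-subalgebra of B(C^d); it is automatically weakly closed. *)
Record vNalg (C : numClosedFieldType) := VNalg {
  vN_dim : nat;
  vN_space : {vspace 'M[C]_vN_dim};
  vN_one : 1%:M \in vN_space;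
  vN_mul : forall a b, a \in vN_space -> b \in vN_space -> a *m b \in vN_space;
  vN_star : forall a, a \in vN_space -> adjmx a \in vN_space
}.

Definition elt (C : numClosedFieldType) (M : vNalg C) : Type :=
  subvs_of (vN_space M).

HB.instance Definition _ C (M : vNalg C) := Vector.on (elt M).

Section Elements.
Variables (C : numClosedFieldType) (M : vNalg C).
Implicit Types x y z : elt M.

Definition opval x : 'M[C]_(vN_dim M) := vsval x.

Lemma opvalP x : opval x \in vN_space M.
Proof. exact: subvsP. Qed.

Lemma opval_inj : injective opval.
Proof. exact: subvs_inj. Qed.

Definition vone : elt M := Subvs (vN_one M).
Definition vmul x y : elt M := Subvs (vN_mul (opvalP x) (opvalP y)).
Definition vstar x : elt M := Subvs (vN_star (opvalP x)).

Lemma vmulA : associative vmul.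
Proof. by move=> x y z; apply: opval_inj; rewrite /= mulmxA. Qed.
Lemma vmul1l : left_id vone vmul.
Proof. by move=> x; apply: opval_inj; rewrite /= mul1mx. Qed.
Lemma vmul1r : right_id vone vmul.
Proof. by move=> x; apply: opval_inj; rewrite /= mulmx1. Qed.
Lemma vmulDl : left_distributive vmul +%R.
Proof. by move=> x y z; apply: opval_inj; rewrite /= mulmxDl. Qed.
Lemma vmulDr : right_distributive vmul +%R.
Proof. by move=> x y z; apply: opval_inj; rewrite /= mulmxDr. Qed.

HB.instance Definition _ :=
  GRing.Zmodule_isPzRing.Build (elt M) vmulA vmul1l vmul1r vmulDl vmulDr.

Definition vpos x : Prop := psdmx (opval x).

Definition faithful_positive (phi : {scalar elt M}) : Prop :=
  (forall x, 0 <= phi (vstar x * x)) /\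
  (forall x, phi (vstar x * x) = 0 -> x = 0).

End Elements.

(** * Hilbert space structures *)

(* A Hilbert space is a vector space V together with an inner product
   [ip : V -> V -> C], conjugate-linear in its first argument. *)
Section Hilbert.
Variable C : numClosedFieldType.

Definition adjoint_rel (V W : vectType C) (ipV : V -> V -> C)
    (ipW : W -> W -> C) (T : 'Hom(V, W)) (S : 'Hom(W, V)) : Prop :=
  forall x y, ipW (T x) y = ipV x (S y).

Definition adjoint (V W : vectType C) (ipV : V -> V -> C) (ipW : W -> W -> C)
    (T : 'Hom(V, W)) : 'Hom(W, V) :=
  xget 0 [set S | adjoint_rel ipV ipW T S]%classic.

Definition oppos (V : vectType C) (ip : V -> V -> C) (T : 'End(V)) : Prop :=
  forall x, 0 <= ip x (T x).

Definition oproot (V : vectType C) (ip : V -> V -> C) (k : nat) (T : 'End(V)) :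
    'End(V) :=
  xget 0 [set S : 'End(V) | oppos ip S /\ iter k (comp_lfun S) \1%VF = T]%classic.

Definition optrace (V : vectType C) (T : 'End(V)) : C :=
  \sum_i coord (vbasis {:V}) i (T (tnth (vbasis {:V}) i)).

(* V (x) W is realised as the space of coordinate matrices with respect to the
   basis b_i (x) c_j, where (b_i) and (c_j) are the bases [vbasis] of V and W
   (which are not orthonormal in general). *)
Local Notation tens V W := 'M[C]_(\dim {:V}, \dim {:W}).

Definition tpure (V W : vectType C) (x : V) (y : W) : tens V W :=
  \matrix_(i, j) (coord (vbasis {:V}) i x * coord (vbasis {:W}) j y).

(* The linear map V (x) W -> U induced by a bilinear map V -> W -> U. *)
Definition tlift (V W U : vectType C) (f : V -> W -> U) : 'Hom(tens V W, U) :=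
  linfun (fun T : tens V W =>
    \sum_i \sum_j
      T i j *: f (tnth (vbasis {:V}) i) (tnth (vbasis {:W}) j)).

Definition tmap (V W V' W' : vectType C) (A : 'Hom(V, V')) (B : 'Hom(W, W')) :
    'Hom(tens V W, tens V' W') :=
  tlift (fun x y => tpure (A x) (B y)).

(* <x (x) y, x' (x) y'> = <x, x'> <y, y'>, extended sesquilinearly. *)
Definition tip (V W : vectType C) (ipV : V -> V -> C) (ipW : W -> W -> C)
    (S T : tens V W) : C :=
  \sum_i \sum_j \sum_k \sum_l
    Num.conj (S i j) * T k l *
    (ipV (tnth (vbasis {:V}) i) (tnth (vbasis {:V}) k) *
     ipW (tnth (vbasis {:W}) j) (tnth (vbasis {:W}) l)).

End Hilbert.

(** * The GNS space *)

(* The GNS map identifies L^2(M) with M itself, so that B(L^2(N), L^2(M)) is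
   'Hom(elt N, elt M) and linear maps N -> M are operators; only the inner
   product depends on the functional. *)
Section GNS.
Variables (C : numClosedFieldType) (M : vNalg C).

Definition gns (phi : {scalar elt M}) (x y : elt M) : C := phi (vstar x * y).

Definition lmul (x : elt M) : 'End(elt M) := linfun (fun y : elt M => x * y).

Definition commutant (T : 'End(elt M)) : Prop :=
  forall x : elt M, (T \o lmul x)%VF = (lmul x \o T)%VF.

Definition markov_trace (x : elt M) : C := optrace (lmul x).

(* Q is the positive invertible element with phi = Tr_M(Q .). *)
Definition is_density (phi : {scalar elt M}) (Q : elt M) : Prop :=
  [/\ vpos Q, invertible Q & forall x, phi x = markov_trace (Q * x)].

Definition modular (Q : elt M) : 'End(elt M) :=
  linfun (fun x : elt M => Q * x * ringinv Q).

Definition mult : 'Hom('M[C]_(\dim {: elt M}, \dim {: elt M}), elt M) :=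
  tlift (fun x y : elt M => x * y).

End GNS.

Section Maps.
Variables (C : numClosedFieldType) (N M : vNalg C).

Definition star_hom (theta : 'Hom(elt N, elt M)) : Prop :=
  (forall x y, theta (x * y) = theta x * theta y) /\
  (forall x, theta (vstar x) = vstar (theta x)).

(* [x_ij] is positive in M_k(M), acting on k copies of the space of M. *)
Definition ampl_pos (P : vNalg C) (k : nat) (x : 'I_k -> 'I_k -> elt P) : Prop :=
  forall xi : 'I_k -> 'cV[C]_(vN_dim P),
    0 <= \sum_i \sum_j dotcv (xi i) (opval (x i j) *m xi j).

Definition completely_positive (A : 'Hom(elt N, elt M)) : Prop :=
  forall (k : nat) (x : 'I_k -> 'I_k -> elt N),
    ampl_pos x -> ampl_pos (fun i j => A (x i j)).

Definition schur (phiN : {scalar elt N}) (A B : 'Hom(elt N, elt M)) :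
    'Hom(elt N, elt M) :=
  (mult M \o tmap A B \o
     adjoint (tip (gns phiN) (gns phiN)) (gns phiN) (mult N))%VF.

Definition lspan (V : vectType C) (P : set V) : set V :=
  [set v | exists (n : nat) (c : 'I_n -> C) (w : 'I_n -> V),
     (forall i, P (w i)) /\ v = \sum_i c i *: w i]%classic.

(* M' X N' *)
Definition bimodule (X : 'Hom(elt N, elt M)) : set 'Hom(elt N, elt M) :=
  lspan [set T | exists (a : 'End(elt M)) (b : 'End(elt N)),
     [/\ commutant a, commutant b & T = (a \o X \o b)%VF]]%classic.

(* V^theta and (V^theta)^* *)
Definition intertwiners (theta : 'Hom(elt N, elt M)) :
    set 'Hom(elt M, elt N) :=
  [set v | forall y : elt N, (lmul y \o v)%VF = (v \o lmul (theta y))%VF]%classic.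

Definition intertwiners_adj (phiN : {scalar elt N}) (phiM : {scalar elt M})
    (theta : 'Hom(elt N, elt M)) : set 'Hom(elt N, elt M) :=
  [set adjoint (gns phiM) (gns phiN) v | v in intertwiners theta]%classic.

End Maps.

(** * Decomposition into matrix blocks *)

(* A *-isomorphism of N onto the direct sum of the matrix algebras
   M_{n(alpha)}, given by its components. *)
Record blocks (C : numClosedFieldType) (N : vNalg C) := Blocks {
  blk : finType;
  bsize : blk -> nat;
  bsize_gt0 : forall al, (0 < bsize al)%N;
  bproj : forall al, 'Hom(elt N, 'M[C]_(bsize al));
  bprojM : forall al x y, bproj al (x * y) = bproj al x *m bproj al y;
  bproj_star : forall al x, bproj al (vstar x) = adjmx (bproj al x);
  bproj_bij : forall y : (forall al, 'M[C]_(bsize al)),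
    exists! x : elt N, forall al, bproj al x = y al
}.

Section Identification.
Variables (C : numClosedFieldType) (N M : vNalg C) (D : blocks N).

(* The inclusion of M_{n(alpha)} in N. *)
Definition bincl (al : blk D) (y : 'M[C]_(bsize al)) : elt N :=
  xget 0 [set x : elt N | bproj al x = y /\
    forall be, be != al -> bproj be x = 0]%classic.

Definition bunit (al : blk D) : elt N := bincl (al := al) 1%:M.

(* W is a unitary from C^n(alpha) (x) C^k onto Im theta(1_alpha) in L^2(M)
   turning x (x) 1 into theta(x), for x in M_{n(alpha)}. *)
Definition is_identification (phiM : {scalar elt M})
    (theta : 'Hom(elt N, elt M)) (al : blk D) (k : nat)
    (W : 'Hom('cV[C]_(bsize al * k), elt M)) : Prop :=
  [/\ forall xi eta, gns phiM (W xi) (W eta) = dotcv xi eta,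
      limg W = limg (lmul (theta (bunit al))) &
      forall (x : 'M[C]_(bsize al)) xi,
        theta (bincl x) * W xi = W ((x *t (1%:M : 'M[C]_k)) *m xi)].

(* The operator 1 (x) s on C^n(alpha) (x) C^k, transported along W to the range
   of W; W^-1 inverts the injective map W on its range. *)
Definition on_range (al : blk D) (k : nat)
    (W : 'Hom('cV[C]_(bsize al * k), elt M)) (s : 'M[C]_k) : 'End(elt M) :=
  (W \o linfun (mulmx ((1%:M : 'M[C]_(bsize al)) *t s)) \o W^-1)%VF.

(* The sum over alpha of theta(1_alpha) (1 (x) s_alpha) theta(1_alpha). *)
Definition block_operator (theta : 'Hom(elt N, elt M)) (k : blk D -> nat)
    (W : forall al, 'Hom('cV[C]_(bsize al * k al), elt M))
    (s : forall al, 'M[C]_(k al)) : 'End(elt M) :=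
  \sum_(al : blk D)
    (lmul (theta (bunit al)) \o on_range (W al) (s al)
       \o lmul (theta (bunit al)))%VF.

End Identification.

(* x |-> Q_M^{-1/4} u^{1/2} theta(Q_N^{1/4} x Q_N^{1/4}) u^{1/2} Q_M^{-1/4} *)
Definition adjacency (C : numClosedFieldType) (N M : vNalg C)
    (QN : elt N) (QM : elt M) (theta : 'Hom(elt N, elt M)) (u : elt M) :
    'Hom(elt N, elt M) :=
  let q := ringinv (posroot (@vpos _ M) 4 QM) in
  let r := posroot (@vpos _ N) 4 QN in
  let s := posroot (@vpos _ M) 2 u in
  linfun (fun x : elt N => q * s * theta (r * x * r) * s * q).

(* Main.v *)
Require Import Defs.
From HB Require Import structures.
From mathcomp Require Import all_boot all_order all_algebra ring.
From mathcomp Require Import boolp classical_sets reals.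
From mathcomp.real_closed Require Import complex mxtens.

Set Implicit Arguments.
Unset Strict Implicit.
Unset Printing Implicit Defensive.

Import Order.TTheory GRing.Theory Num.Theory.
Local Open Scope ring_scope.

(** Write e_ij for the matrix units of the blocks of N, h and r for the positive
fourth roots of Q_M and Q_N, and q for the inverse of h. Everything rests on one
element of M,
  a = sum_alpha n(alpha)^-1 sum_ij theta(e_ij r^-1) Q_M^(-1/2) theta(r^-1 e_ji).
It is positive, each term being of the form c^* c; it commutes with theta(N), by
the invariance of sum_ij e_ij (x) e_ji ([casimir_outer]); and on the range of
theta(1_alpha) it is n(alpha)^-1 (1 (x) v_alpha), because the sum over i and j
computes a partial trace ([tens_partial_trace], [range_compression]). It is
definite on the range of theta(1) ([compression_eq0]), so that v_alpha is
positive and invertible, and a + 1 - theta(1) is invertible in M. Then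
u = theta(1) (a + 1 - theta(1))^-1 is the inverse of a in the corner of
theta(1), and it acts on the range of theta(1_alpha) as
n(alpha) (1 (x) v_alpha^-1).

The formula phi_N = Tr_N(Q_N .) gives the adjoint of the multiplication,
  m_N^*(x) = sum_alpha n(alpha)^-1 sum_ij x e_ij (x) Q_N^-1 e_ji
([adjoint_mult]). Splitting Q_N^-1 = r^-2 r^-2 across the tensor sign
([casimir_inner]) and putting s = u^(1/2), which commutes with theta(N), one
finds
  (A * A)(x) = q s theta(r x) (s a s) theta(r) s q = A(x)
for the Schur product, since s a s = theta(1) ([adjacency_op_schur]).

Complete positivity of A reduces to that of theta ([star_hom_cp]), as A is theta
between two operations of the form y |-> c^* y c.

Finally nabla_M^(1/4) A nabla_N^(-1/4) is the map
  y |-> theta(y) u theta(r^2) q^2,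
whereas the adjoints of the intertwiners are the maps y |-> theta(y) z with z in
M. Right multiplication by h^2 theta(r^-2) a z belongs to M' and turns the first
map into the second ([adjacency_bimodule]).

The roots are handled as follows. A positive matrix has a positive k-th root which
is a polynomial in it, hence lies in every algebra containing it; roots are unique
because A^k X = X B^k implies A X = X B for positive A and B
([psdmx_pow_intertwine]). Operators on an inner product space are reduced to
matrices by the square root of the Gram matrix ([oproot_eq]), which identifies the
fourth root of the modular operator with x |-> h x h^-1 ([oproot_modular]). *)
(** * Sesquilinear forms *)

Definition sesquilinear_form (C : numClosedFieldType) (V : lmodType C)
    (f : V -> V -> C) : Prop :=
  [/\ forall x y z, f (x + y) z = f x z + f y z,
      forall x y z, f x (y + z) = f x y + f x z,
      forall a x y, f (a *: x) y = Num.conj a * f x y &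
      forall a x y, f x (a *: y) = a * f x y].

(** Polarization: the form is real at x + y and at x + i y. *)
Lemma sesquilinear_herm (C : numClosedFieldType) (V : lmodType C)
    (f : V -> V -> C) :
  sesquilinear_form f -> (forall x, f x x \is Num.real) ->
  forall x y, f y x = Num.conj (f x y).
Proof.
move=> [fDl fDr fZl fZr] f_real x y.
have cross z : Num.conj (f x z + f z x) = f x z + f z x.
  apply/CrealP; have -> : f x z + f z x = f (x + z) (x + z) - f x x - f z z.
    by rewrite fDl !fDr; ring.
  by rewrite !rpredB.
have h1 := cross y; have h2 := cross ('i *: y).
rewrite fZr fZl conjCi in h2.
rewrite !rmorphD !rmorphM rmorphN /= conjCi in h1 h2.
have h2' : - Num.conj (f x y) + Num.conj (f y x) = f x y - f y x.
  apply: (mulfI (neq0Ci C)).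
  by transitivity ('i * f x y + - 'i * f y x); [rewrite -h2|]; ring.
have : 2%:R * f y x = 2%:R * Num.conj (f x y).
  transitivity ((f x y + f y x) - (f x y - f y x)); first by ring.
  by rewrite -h1 -h2'; ring.
by apply: mulfI; rewrite pnatr_eq0.
Qed.

(** * Positive matrices *)

Section PositiveMatrices.
Variable C : numClosedFieldType.

Lemma delta_mx_sandwich m n p q (A : 'M[C]_(n, p)) (i : 'I_m) j a (b : 'I_q) :
  delta_mx i j *m A *m delta_mx a b = A j a *: delta_mx i b.
Proof.
apply/matrixP => x y; rewrite !mxE (bigD1 a) //= big1 ?addr0 => [|l /negPf ne].
  rewrite !mxE (bigD1 j) //= big1 ?addr0 => [|l /negPf ne].
    rewrite !mxE !eqxx andbT /=.
    by case: (x == i); case: (y == b); rewrite ?(mulr1, mul1r, mulr0, mul0r).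
  by rewrite mxE ne andbF mul0r.
by rewrite [delta_mx a b _ _]mxE ne mulr0.
Qed.

Lemma injective_unitmx n (A : 'M[C]_n) :
  (forall xi : 'cV_n, A *m xi = 0 -> xi = 0) -> A \in unitmx.
Proof.
move=> A_inj; rewrite -unitmx_tr -row_free_unit -kermx_eq0; apply/rowV0P => v.
move=> /sub_kermxP vA; apply: trmx_inj; rewrite trmx0; apply: A_inj.
by rewrite -[A]trmxK -trmx_mul vA trmx0.
Qed.

Lemma adjmxM m n p (A : 'M[C]_(m, n)) (B : 'M[C]_(n, p)) :
  adjmx (A *m B) = adjmx B *m adjmx A.
Proof. by rewrite /adjmx trmx_mul map_mxM. Qed.

Lemma adjmxD m n (A B : 'M[C]_(m, n)) : adjmx (A + B) = adjmx A + adjmx B.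
Proof. by rewrite /adjmx linearD map_mxD. Qed.

Lemma adjmxZ m n a (A : 'M[C]_(m, n)) : adjmx (a *: A) = Num.conj a *: adjmx A.
Proof. by rewrite /adjmx linearZ map_mxZ. Qed.

Lemma adjmxK m n (A : 'M[C]_(m, n)) : adjmx (adjmx A) = A.
Proof. by apply/matrixP=> i j; rewrite !mxE conjCK. Qed.

Lemma adjmx_delta m n i j :
  adjmx (delta_mx i j : 'M[C]_(m, n)) = delta_mx j i.
Proof. by rewrite /adjmx trmx_delta map_delta_mx. Qed.

Lemma dotcvE n (xi eta : 'cV[C]_n) :
  dotcv xi eta = \sum_i Num.conj (xi i 0) * eta i 0.
Proof. by rewrite /dotcv mxE; apply: eq_bigr => i _; rewrite !mxE. Qed.

Lemma dotcv_sesqui n : sesquilinear_form (@dotcv C n).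
Proof.
split=> *; rewrite /dotcv ?adjmxD ?adjmxZ ?mulmxDl ?mulmxDr -?scalemxAl.
all: by rewrite -?scalemxAr ?mxE.
Qed.

Lemma dotcv_ge0 n (xi : 'cV[C]_n) : 0 <= dotcv xi xi.
Proof.
by rewrite dotcvE sumr_ge0 // => i _; rewrite mulrC mul_conjC_ge0.
Qed.

Lemma dotcv_eq0 n (xi : 'cV[C]_n) : dotcv xi xi = 0 -> xi = 0.
Proof.
rewrite dotcvE => /eqP; rewrite psumr_eq0; last first.
  by move=> i _; rewrite mulrC mul_conjC_ge0.
move=> /allP h; apply/matrixP => i j; rewrite (ord1 j) mxE.
have /= := h i (mem_index_enum i).
by rewrite mulf_eq0 conjC_eq0 orbb => /eqP.
Qed.

Lemma dotcv_adj m n (A : 'M[C]_(m, n)) xi eta :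
  dotcv xi (A *m eta) = dotcv (adjmx A *m xi) eta.
Proof. by rewrite /dotcv adjmxM adjmxK mulmxA. Qed.

Lemma mx_entry_dotcv m n (A : 'M[C]_(m, n)) i j :
  A i j = dotcv (delta_mx i 0) (A *m delta_mx j 0).
Proof. by rewrite /dotcv adjmx_delta -rowE -colE !mxE. Qed.

Lemma psdmx_herm n (A : 'M[C]_n) : psdmx A -> adjmx A = A.
Proof.
move=> A_psd; have [dDl dDr dZl dZr] := dotcv_sesqui n.
have ses : sesquilinear_form (fun xi eta : 'cV[C]_n => dotcv xi (A *m eta)).
  by split=> *; rewrite ?mulmxDr -?scalemxAr.
have herm := sesquilinear_herm ses (fun xi => ger0_real (A_psd xi)).
by apply/matrixP => i j; rewrite !mxE [RHS]mx_entry_dotcv herm -mx_entry_dotcv.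
Qed.

Lemma psdmx_gram m n (A : 'M[C]_(m, n)) : psdmx (adjmx A *m A).
Proof.
by move=> xi; rewrite -mulmxA dotcv_adj adjmxK dotcv_ge0.
Qed.

(** Eigenvalues are listed with multiplicity, so that the l i need not be
distinct. *)
Definition spectral_resolution n (A : 'M[C]_n) (l : 'I_n -> C)
    (e : 'I_n -> 'M[C]_n) : Prop :=
  [/\ forall i, 0 <= l i, forall i, adjmx (e i) = e i,
      forall i j, e i *m e j = e i *+ (i == j), \sum_i e i = 1%:M &
      A = \sum_i l i *: e i].

Lemma psdmx_resolution n (A : 'M[C]_n) :
  psdmx A -> exists l e, spectral_resolution A l e.
Proof.
move=> A_psd; have A_herm := psdmx_herm A_psd.
have /orthomx_spectralP : A \is normalmx.
  by apply/normalmxP; rewrite -/(adjmx A) A_herm.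
rewrite (invmx_unitary (spectral_unitarymx A)).
have := unitarymxP (spectral_unitarymx A).
move: (spectralmx A) (spectral_diag A) => U d.
rewrite -/(adjmx U) => U_unit def_A; have U_unit' := mulmx1C U_unit.
pose e i := adjmx U *m delta_mx i i *m U.
exists (d 0), e; split=> [i|i|i j||].
- have : U *m A *m adjmx U = diag_mx d.
    by rewrite def_A !mulmxA U_unit mul1mx -mulmxA U_unit mulmx1.
  move=> /matrixP /(_ i i); rewrite mx_entry_dotcv !mxE eqxx mulr1n => <-.
  by rewrite -!mulmxA dotcv_adj; apply: A_psd.
- by rewrite /e !adjmxM adjmxK adjmx_delta mulmxA.
- rewrite /e -!mulmxA (mulmxA U) U_unit mul1mx (mulmxA (delta_mx i i)).
  rewrite mul_delta_mx_cond; case: eqP => [->|_]; rewrite ?mulr1n //.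
  by rewrite !mulr0n mul0mx mulmx0.
- rewrite -mulmx_suml -mulmx_sumr -[RHS]U_unit'.
  rewrite -[in RHS](mulmx1 (adjmx U)); congr (_ *m _ *m _).
  by apply/matrixP => i j; rewrite summxE [RHS]mxE (bigD1 i) //= big1 => [|k /negPf ki];
    rewrite !mxE ?eqxx ?addr0 // 1?eq_sym ?ki // eq_sym.
- rewrite {1}def_A diag_mx_sum_delta mulmx_sumr mulmx_suml; apply: eq_bigr => i _.
  by rewrite -scalemxAr -scalemxAl.
Qed.

Section Resolution.
Variables (n : nat) (A : 'M[C]_n) (l : 'I_n -> C) (e : 'I_n -> 'M[C]_n).
Hypothesis resA : spectral_resolution A l e.

Lemma resolution_pow k : A ^+ k = \sum_i l i ^+ k *: e i.
Proof.
case: resA => _ _ ee e1 ->; elim: k => [|k IHk].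
  by rewrite expr0 -[LHS]/1%:M -e1; apply: eq_bigr => i _; rewrite scale1r.
rewrite exprSr IHk mulr_suml; apply: eq_bigr => i _.
rewrite mulr_sumr (bigD1 i) //= big1 ?addr0 => [|j /negPf neq_ji].
  by rewrite -[_ * _]scalemxAl -scalemxAr ee eqxx scalerA exprSr.
by rewrite -[_ * _]scalemxAl -scalemxAr ee eq_sym neq_ji !scaler0.
Qed.

Lemma resolution_mull i k : e i *m A ^+ k = l i ^+ k *: e i.
Proof.
case: resA => _ _ ee _ _; rewrite resolution_pow mulmx_sumr (bigD1 i) //=.
rewrite big1 ?addr0 => [|j /negPf neq_ji]; rewrite -scalemxAr ee ?eqxx //.
by rewrite eq_sym neq_ji scaler0.
Qed.

Lemma resolution_mulr i k : A ^+ k *m e i = l i ^+ k *: e i.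
Proof.
case: resA => _ _ ee _ _; rewrite resolution_pow mulmx_suml (bigD1 i) //=.
rewrite big1 ?addr0 => [|j /negPf neq_ji]; rewrite -scalemxAl ee ?eqxx //.
by rewrite neq_ji scaler0.
Qed.

Lemma resolution_comb (mu : 'I_n -> C) k :
  (\sum_i mu i *: e i) ^+ k = \sum_i mu i ^+ k *: e i.
Proof.
case: resA => _ _ ee e1 _; elim: k => [|k IHk].
  by rewrite expr0 -[LHS]/1%:M -e1; apply: eq_bigr => i _; rewrite scale1r.
rewrite exprSr IHk mulr_suml; apply: eq_bigr => i _.
rewrite mulr_sumr (bigD1 i) //= big1 ?addr0 => [|j /negPf neq_ji].
  by rewrite -[_ * _]scalemxAl -scalemxAr ee eqxx scalerA exprSr.
by rewrite -[_ * _]scalemxAl -scalemxAr ee eq_sym neq_ji !scaler0.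
Qed.

Lemma resolution_comb_psd (mu : 'I_n -> C) :
  (forall i, 0 <= mu i) -> psdmx (\sum_i mu i *: e i).
Proof.
case: resA => _ eH ee _ _ mu_ge0 xi; have [_ _ _ dZr] := dotcv_sesqui n.
rewrite mulmx_suml /dotcv mulmx_sumr summxE sumr_ge0 // => i _.
rewrite -scalemxAl -scalemxAr mxE mulr_ge0 //.
have <- : adjmx (e i) *m e i = e i by rewrite eH ee eqxx.
exact: psdmx_gram.
Qed.

End Resolution.

(** Cutting the hypothesis by the spectral projections e i of A and f j of B gives
l i ^ k (e i X f j) = m j ^ k (e i X f j), so that e i X f j vanishes unless the
nonnegative eigenvalues l i and m j agree. Both the uniqueness of roots (X = 1)
and their commutation properties (A = B) are special cases. *)
Lemma psdmx_pow_intertwine n (A B X : 'M[C]_n) k : (0 < k)%N ->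
  psdmx A -> psdmx B -> A ^+ k *m X = X *m B ^+ k -> A *m X = X *m B.
Proof.
move=> k_gt0 /psdmx_resolution[l [e resA]] /psdmx_resolution[m [f resB]] AX.
have [l_ge0 _ _ e1 _] := resA; have [m_ge0 _ _ f1 _] := resB.
suff eq_ij i j : e i *m (A *m X) *m f j = e i *m (X *m B) *m f j.
  rewrite -[LHS]mulmx1 -[RHS]mulmx1 -[in LHS]f1 -f1 !mulmx_sumr.
  apply: eq_bigr => j _; rewrite -[LHS]mul1mx -[RHS]mul1mx -[in LHS]e1 -e1.
  by rewrite !mulmx_suml; apply: eq_bigr => i _; have := eq_ij i j; rewrite !mulmxA.
have := congr1 (fun Y => e i *m Y *m f j) AX.
rewrite !mulmxA (resolution_mull resA) -!mulmxA (resolution_mulr resB).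
rewrite -(expr1 A) -(expr1 B) (resolution_mulr resB) !mulmxA (resolution_mull resA).
rewrite -!scalemxAl -!scalemxAr !expr1.
have [->//|neq] := eqVneq (l i) (m j).
move=> /eqP; rewrite -subr_eq0 -scalerBl scaler_eq0 subr_eq0.
rewrite eqrXn2 // (negPf neq) /= => /eqP eij0.
by rewrite -!mulmxA in eij0; rewrite -!mulmxA eij0 !scaler0.
Qed.

Lemma psdmx_root_uniq n (A B : 'M[C]_n) k : (0 < k)%N ->
  psdmx A -> psdmx B -> A ^+ k = B ^+ k -> A = B.
Proof.
move=> k_gt0 A_psd B_psd eqAB.
have := @psdmx_pow_intertwine n A B 1%:M k k_gt0 A_psd B_psd.
by rewrite !mulmx1 !mul1mx; apply.
Qed.

Lemma interpolation (s : seq C) (f : C -> C) :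
  exists p : {poly C}, {in s, forall x, p.[x] = f x}.
Proof.
elim: s => [|a s [p p_s]]; first by exists 0.
have [a_s|a_s] := boolP (a \in s).
  by exists p => x; rewrite inE => /predU1P[->|]; apply: p_s.
pose q := \prod_(b <- s) ('X - b%:P).
exists (p + ((f a - p.[a]) / q.[a]) *: q) => x; rewrite inE hornerD hornerZ.
have [-> _|neq /= x_s] := eqVneq x a.
  have : ~~ root q a by rewrite root_prod_XsubC.
  by rewrite rootE => ?; rewrite divfK // addrC subrK.
have : root q x by rewrite root_prod_XsubC.
by rewrite rootE => /eqP->; rewrite mulr0 addr0 p_s.
Qed.

(** The polynomial interpolates the k-th root on the spectrum of A. *)
Lemma psdmx_root_exists n (A : 'M[C]_n) k : (0 < k)%N -> psdmx A ->
  exists2 p : {poly C}, psdmx (\sum_(j < size p) p`_j *: A ^+ j) &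
    (\sum_(j < size p) p`_j *: A ^+ j) ^+ k = A.
Proof.
move=> k_gt0 /psdmx_resolution[l [e resA]]; have [l_ge0 _ _ _ def_A] := resA.
have [p p_root] := interpolation (codom l) k.-root.
have eqB : \sum_(j < size p) p`_j *: A ^+ j = \sum_i k.-root (l i) *: e i.
  transitivity (\sum_i \sum_(j < size p) (p`_j * l i ^+ j) *: e i).
    rewrite exchange_big; apply: eq_bigr => j _ /=.
    rewrite (resolution_pow resA) scaler_sumr.
    by apply: eq_bigr => i _; rewrite scalerA.
  apply: eq_bigr => i _; rewrite -scaler_suml -horner_coef p_root //.
  exact: codom_f.
exists p; rewrite eqB.
- by apply: (resolution_comb_psd resA) => i; rewrite rootC_ge0.
- by rewrite (resolution_comb resA) [RHS]def_A; apply: eq_bigr => i _; rewrite rootCK.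
Qed.

End PositiveMatrices.

(** * Adjoints and traces of linear maps *)

(** [lfunE] needs a canonical linear structure, which functions such as
x |-> a x b lack. *)
Lemma linfunE (K : fieldType) (V W : vectType K) (f : V -> W) :
  linear f -> linfun f =1 f.
Proof.
move=> f_lin x.
pose F : {linear V -> W} := HB.pack f (GRing.isLinear.Build _ _ _ _ f f_lin).
by rewrite -[f]/(F : V -> W) lfunE.
Qed.

Section VectorSpaces.
Variable K : fieldType.
Implicit Types V W : vectType K.

Definition basisv V (i : 'I_(\dim {:V})) : V := tnth (vbasis {:V}) i.

Lemma coord_basisv V (x : V) : x = \sum_i coord (vbasis {:V}) i x *: basisv i.
Proof.
rewrite {1}(coord_vbasis (memvf x)); apply: eq_bigr => i _.
by rewrite /basisv (tnth_nth 0).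
Qed.

Lemma coord_basisvE V i j : coord (vbasis {:V}) i (basisv j) = (i == j)%:R.
Proof.
rewrite /basisv (tnth_nth 0) coord_free ?(basis_free (vbasisP _)) //.
by rewrite eq_sym.
Qed.

End VectorSpaces.

Section Adjoint.
Variables (C : numClosedFieldType).

Definition nondegenerate_form (V : vectType C) (ip : V -> V -> C) : Prop :=
  forall y, (forall x, ip x y = 0) -> y = 0.

Definition inner_product (V : vectType C) (ip : V -> V -> C) : Prop :=
  [/\ sesquilinear_form ip, forall x, 0 <= ip x x & forall x, ip x x = 0 -> x = 0].

Lemma sesquilinear_suml (V : vectType C) (ip : V -> V -> C) :
  sesquilinear_form ip -> forall (I : Type) (r : seq I) (P : pred I) (x : I -> V) y,
  ip (\sum_(i <- r | P i) x i) y = \sum_(i <- r | P i) ip (x i) y.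
Proof.
move=> [ipDl _ ipZl _] I r P x y; apply: (big_morph (ip^~ y)).
  by move=> u v; apply: ipDl.
by rewrite -(scale0r (0 : V)) ipZl conjC0 mul0r.
Qed.

Lemma sesquilinear_sumr (V : vectType C) (ip : V -> V -> C) :
  sesquilinear_form ip -> forall (I : Type) (r : seq I) (P : pred I) x (y : I -> V),
  ip x (\sum_(i <- r | P i) y i) = \sum_(i <- r | P i) ip x (y i).
Proof.
move=> [_ ipDr _ ipZr] I r P x y; apply: (big_morph (ip x)).
  by move=> u v; apply: ipDr.
by rewrite -(scale0r (0 : V)) ipZr mul0r.
Qed.

Lemma inner_product_herm (V : vectType C) (ip : V -> V -> C) :
  inner_product ip -> forall x y, ip y x = Num.conj (ip x y).
Proof.
by move=> [ses ge0 _]; apply: sesquilinear_herm => // x; apply: ger0_real.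
Qed.

Lemma inner_product_nondeg (V : vectType C) (ip : V -> V -> C) :
  inner_product ip -> nondegenerate_form ip.
Proof. by move=> [_ _ def] y /(_ y) /def. Qed.

Lemma nondegenerate_inj (V : vectType C) (ip : V -> V -> C) :
  sesquilinear_form ip -> nondegenerate_form ip ->
  forall y z, (forall x, ip x y = ip x z) -> y = z.
Proof.
move=> [_ ipDr _ ipZr] nd y z eq_yz; apply/eqP; rewrite -subr_eq0; apply/eqP.
by apply: nd => x; rewrite -scaleN1r ipDr ipZr eq_yz mulN1r subrr.
Qed.

Lemma adjoint_eq (V W : vectType C) ipV ipW (T : 'Hom(V, W)) S :
  sesquilinear_form ipV -> nondegenerate_form ipV ->
  adjoint_rel ipV ipW T S -> adjoint ipV ipW T = S.
Proof.
move=> ses nd TS; apply: xget_unique => //= S' TS'; apply/lfunP => y.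
by apply: (nondegenerate_inj ses nd) => x; rewrite -TS -TS'.
Qed.

(** By nondegeneracy z |-> (ip b_i z)_i is bijective, for the basis (b_i) of V. *)
Lemma adjointP (V W : vectType C) ipV ipW (T : 'Hom(V, W)) :
  inner_product ipV -> sesquilinear_form ipW ->
  adjoint_rel ipV ipW T (adjoint ipV ipW T).
Proof.
move=> ipV_ip sesW; have [sesV _ _] := ipV_ip.
have [ipVDl ipVDr ipVZl ipVZr] := sesV; have [ipWDl ipWDr ipWZl ipWZr] := sesW.
apply: xgetPex.
pose G := linfun (fun z : V => \row_i ipV (basisv i) z).
pose H := linfun (fun y : W => \row_i ipW (T (basisv i)) y).
have GE z i : G z 0 i = ipV (basisv i) z.
  rewrite /G linfunE ?mxE // => a u v; apply/rowP => j.
  by rewrite !mxE ipVDr ipVZr.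
have HE y i : H y 0 i = ipW (T (basisv i)) y.
  rewrite /H linfunE ?mxE // => a u v; apply/rowP => j.
  by rewrite !mxE ipWDr ipWZr.
have kerG : (lker G == 0)%VS.
  apply/lker0P => y z eqG.
  apply: (nondegenerate_inj sesV (inner_product_nondeg ipV_ip)) => x.
  rewrite (coord_basisv x) !(sesquilinear_suml sesV); apply: eq_bigr => i _.
  by rewrite !ipVZl -!GE eqG.
have imG : limg G = fullv.
  apply/eqP; rewrite eqEdim subvf /= limg_dim_eq ?(eqP kerG) ?capv0 //.
  by rewrite !dimvf -[X in (X <= _)%N]/(1 * _)%N mul1n.
exists (G^-1 \o H)%VF => x y.
rewrite [x in LHS]coord_basisv [x in RHS]coord_basisv.
rewrite linear_sum (sesquilinear_suml sesW) (sesquilinear_suml sesV).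
apply: eq_bigr => i _; rewrite linearZ ipWZl ipVZl -HE -GE comp_lfunE.
by rewrite limg_lfunVK // imG memvf.
Qed.

End Adjoint.

Lemma optraceC (C : numClosedFieldType) (V : vectType C) (S T : 'End(V)) :
  optrace (S \o T)%VF = optrace (T \o S)%VF.
Proof.
have eqtr (S' T' : 'End(V)) : optrace (S' \o T')%VF =
    \sum_i \sum_j coord (vbasis {:V}) j (T' (basisv i)) *
                   coord (vbasis {:V}) i (S' (basisv j)).
  apply: eq_bigr => i _; rewrite comp_lfunE -/(basisv i).
  rewrite {1}(coord_basisv (T' (basisv i))).
  rewrite !linear_sum; apply: eq_bigr => j _; by rewrite !linearZ.
rewrite !eqtr exchange_big; apply: eq_bigr => i _; apply: eq_bigr => j _.
by rewrite mulrC.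
Qed.

(** The trace computed in a basis v with dual basis f, such as the matrix units and
the entries of a matrix. *)
Lemma optrace_dual_basis (C : numClosedFieldType) (V : vectType C) (I : finType)
    (v : I -> V) (f : I -> V -> C) (T : 'End(V)) :
  (forall i, scalar (f i)) -> (forall x, x = \sum_i f i x *: v i) ->
  optrace T = \sum_i f i (T (v i)).
Proof.
move=> f_lin dual.
transitivity (\sum_j \sum_i f i (T (basisv j)) * coord (vbasis {:V}) j (v i)).
  apply: eq_bigr => j _; rewrite -/(basisv j) {1}(dual (T (basisv j))).
  by rewrite linear_sum; apply: eq_bigr => i _; rewrite linearZ.
rewrite exchange_big; apply: eq_bigr => i _ /=.
pose F : {scalar V} := HB.pack (f i) (GRing.isLinear.Build _ _ _ _ (f i) (f_lin i)).
have -> x : f i x = F x by [].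
rewrite {2}(coord_basisv (v i)) !linear_sum; apply: eq_bigr => j _.
by rewrite !linearZ mulrC.
Qed.

(** * Calculus in a finite-dimensional von Neumann algebra *)

Section Inverses.
Variable A : pzRingType.
Implicit Types a b : A.

Lemma ringinv_eq a b : a * b = 1 -> b * a = 1 -> ringinv a = b.
Proof.
move=> ab ba; apply: xget_unique => //= c [ac ca].
by rewrite -[c]mul1r -ba -mulrA ac mulr1.
Qed.

Lemma ringinvP a : invertible a -> a * ringinv a = 1 /\ ringinv a * a = 1.
Proof. by move=> [b [ab ba]]; rewrite (ringinv_eq ab ba). Qed.

(** With a^(k+1) b = b a^(k+1) = 1, the left inverse b a^k and the right inverse
a^k b of a coincide. *)
Lemma invertible_root a k : invertible (a ^+ k.+1) -> invertible a.
Proof.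
move=> [b [ab ba]]; exists (b * a ^+ k).
have ca : b * a ^+ k * a = 1 by rewrite -mulrA -exprSr.
have ac : a * (a ^+ k * b) = 1 by rewrite mulrA -exprS.
by rewrite ca -{1}[b * _]mulr1 -{1}ac [b * _ * _]mulrA ca mul1r.
Qed.

Lemma invertible_ringinv a : invertible a -> invertible (ringinv a).
Proof. by move=> /ringinvP[ab ba]; exists a. Qed.

Lemma invertible_exp a k : invertible a -> invertible (a ^+ k).
Proof.
move=> /ringinvP[ab ba]; exists (ringinv a ^+ k).
by rewrite -!exprMn_comm ?ab ?ba ?expr1n // /GRing.comm ab ba.
Qed.

Lemma ringinvX a k : invertible a -> ringinv (a ^+ k) = ringinv a ^+ k.
Proof.
move=> /ringinvP[ab ba]; apply: ringinv_eq; rewrite -exprMn_comm ?ab ?ba ?expr1n //.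
  by rewrite /GRing.comm ab ba.
by rewrite /GRing.comm ab ba.
Qed.

End Inverses.

Section Calculus.
Variables (C : numClosedFieldType) (M : vNalg C).
Implicit Types (a b x y z : elt M) (phi : {scalar elt M}).

Lemma opvalM x y : opval (x * y) = opval x *m opval y. Proof. by []. Qed.
Lemma opval_star x : opval (vstar x) = adjmx (opval x). Proof. by []. Qed.
Lemma opvalD x y : opval (x + y) = opval x + opval y.
Proof. by rewrite /opval linearD. Qed.
Lemma opvalZ c x : opval (c *: x) = c *: opval x.
Proof. by rewrite /opval linearZ. Qed.
Lemma opval0 : opval (0 : elt M) = 0.
Proof. by rewrite /opval linear0. Qed.
Lemma opval_sum (I : Type) (r : seq I) (P : pred I) (F : I -> elt M) :
  opval (\sum_(i <- r | P i) F i) = \sum_(i <- r | P i) opval (F i).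
Proof. by rewrite /opval linear_sum. Qed.
Lemma opvalX x k : opval (x ^+ k) = opval x ^+ k.
Proof. by elim: k => [|k IHk]; rewrite ?expr0 // !exprS opvalM IHk. Qed.

Lemma vstarM x y : vstar (x * y) = vstar y * vstar x.
Proof. by apply: opval_inj; rewrite !(opvalM, opval_star) adjmxM. Qed.
Lemma vstarK : involutive (@vstar C M).
Proof. by move=> x; apply: opval_inj; rewrite !opval_star adjmxK. Qed.
Lemma vstarD x y : vstar (x + y) = vstar x + vstar y.
Proof. by apply: opval_inj; rewrite !(opvalD, opval_star) adjmxD. Qed.
Lemma vstarZ c x : vstar (c *: x) = Num.conj c *: vstar x.
Proof. by apply: opval_inj; rewrite !(opvalZ, opval_star) adjmxZ. Qed.
Lemma vstar1 : vstar (1 : elt M) = 1.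
Proof. by rewrite -[LHS]mulr1 -[X in _ * X]vstarK -vstarM mulr1 vstarK. Qed.

Lemma vscaleAl c x y : c *: (x * y) = (c *: x) * y.
Proof. by apply: opval_inj; rewrite !(opvalZ, opvalM) scalemxAl. Qed.
Lemma vscaleAr c x y : c *: (x * y) = x * (c *: y).
Proof. by apply: opval_inj; rewrite !(opvalZ, opvalM) scalemxAr. Qed.

Lemma lmulE x y : lmul x y = x * y.
Proof.
by rewrite /lmul linfunE // => c u v; rewrite mulrDr vscaleAr.
Qed.

Lemma lmulM x y : lmul (x * y) = (lmul x \o lmul y)%VF.
Proof. by apply/lfunP => z; rewrite comp_lfunE !lmulE mulrA. Qed.

(** ** Positive elements *)

Lemma vpos_herm a : vpos a -> vstar a = a.
Proof. by move=> a_pos; apply/opval_inj/psdmx_herm. Qed.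

Lemma vpos_gram x : vpos (vstar x * x).
Proof. exact: psdmx_gram. Qed.

Lemma vpos_conj x a : vpos a -> vpos (vstar x * a * x).
Proof.
move=> a_pos xi; rewrite !opvalM opval_star -!mulmxA dotcv_adj adjmxK.
exact: a_pos.
Qed.

Lemma vposD a b : vpos a -> vpos b -> vpos (a + b).
Proof.
move=> a_pos b_pos xi; have [_ dDr _ _] := dotcv_sesqui C (vN_dim M).
by rewrite opvalD mulmxDl dDr addr_ge0 ?a_pos ?b_pos.
Qed.

Lemma vpos0 : vpos (0 : elt M).
Proof. by rewrite -[0](mulr0 (vstar 0)); apply: vpos_gram. Qed.

Lemma vposZ c a : 0 <= c -> vpos a -> vpos (c *: a).
Proof.
move=> c_ge0 a_pos xi; have [_ _ _ dZr] := dotcv_sesqui C (vN_dim M).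
by rewrite opvalZ -scalemxAl dZr mulr_ge0 ?a_pos.
Qed.

Lemma vpos_sum (I : Type) (r : seq I) (P : pred I) (F : I -> elt M) :
  (forall i, P i -> vpos (F i)) -> vpos (\sum_(i <- r | P i) F i).
Proof. by move=> F_pos; apply: big_ind => //; [apply: vpos0 | apply: vposD]. Qed.

Lemma vpos_sqr a : vstar a = a -> vpos (a ^+ 2).
Proof. by move=> aH; rewrite expr2 -{1}aH; apply: vpos_gram. Qed.

Lemma vpos_ringinv a : vpos a -> invertible a -> vpos (ringinv a).
Proof.
move=> a_pos /ringinvP[ab ba]; have aH := vpos_herm a_pos.
have bH : vstar (ringinv a) = ringinv a.
  have abs : a * vstar (ringinv a) = 1 by rewrite -{1}aH -vstarM ba vstar1.
  by rewrite -[LHS]mul1r -ba -mulrA abs mulr1.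
have := vpos_conj (ringinv a) a_pos.
by rewrite bH ba mul1r.
Qed.

Lemma vpos_pow_comm a x k : (0 < k)%N -> vpos a ->
  a ^+ k * x = x * a ^+ k -> a * x = x * a.
Proof.
move=> k_gt0 a_pos /(congr1 (@opval C M)); rewrite !opvalM opvalX => eq_ax.
by apply: opval_inj; rewrite !opvalM; apply: psdmx_pow_intertwine eq_ax.
Qed.

Lemma posroot_eq a b k : (0 < k)%N -> vpos b -> b ^+ k = a ->
  posroot (@vpos C M) k a = b.
Proof.
move=> k_gt0 b_pos def_a; apply: xget_unique => //= c [c_pos].
rewrite -def_a => /(congr1 (@opval C M)); rewrite !opvalX => eq_bc.
by apply: opval_inj; apply: psdmx_root_uniq eq_bc.
Qed.

(** The root is a polynomial in a, hence belongs to the algebra. *)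
Lemma posrootP a k : (0 < k)%N -> vpos a ->
  vpos (posroot (@vpos C M) k a) /\ posroot (@vpos C M) k a ^+ k = a.
Proof.
move=> k_gt0 a_pos; have [p b_pos def_a] := psdmx_root_exists k_gt0 a_pos.
pose b := \sum_(j < size p) p`_j *: a ^+ j.
have eq_b : opval b = \sum_(j < size p) p`_j *: opval a ^+ j.
  by rewrite opval_sum; apply: eq_bigr => j _; rewrite opvalZ opvalX.
apply: (@xgetPex _ 0 [set b : elt M | vpos b /\ b ^+ k = a]%classic).
exists b; rewrite /= /vpos eq_b; split=> //.
by apply: opval_inj; rewrite opvalX eq_b.
Qed.

Lemma ringinv_posroot_half a h k : (0 < k)%N -> vpos h -> invertible h ->
  h ^+ (2 * k) = a -> ringinv (posroot (@vpos C M) k a) = ringinv h ^+ 2.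
Proof.
move=> k_gt0 h_pos h_inv def_a; rewrite (@posroot_eq a (h ^+ 2)) ?ringinvX //.
  exact/vpos_sqr/vpos_herm.
by rewrite -exprM.
Qed.

(** Left multiplication by a is then a bijection of the finite-dimensional M. *)
Lemma injective_invertible a : (forall x, a * x = 0 -> x = 0) -> invertible a.
Proof.
move=> a_inj; have ker_a : (lker (lmul a) == 0)%VS.
  apply/lker0P => x y; rewrite !lmulE => /eqP; rewrite -subr_eq0 -mulrBr.
  by move=> /eqP/a_inj/eqP; rewrite subr_eq0 => /eqP.
pose b := ((lmul a)^-1)%VF 1.
have ab : a * b = 1 by rewrite -lmulE lker0_lfunVK.
exists b; split=> //; apply/eqP; rewrite -subr_eq0; apply/eqP/a_inj.
by rewrite mulrBr mulrA ab mul1r mulr1 subrr.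
Qed.

(** ** The GNS inner product *)

Lemma gns_inner phi : faithful_positive phi -> inner_product (gns phi).
Proof.
move=> [phi_ge0 phi_def]; split=> //; rewrite /gns; split=> *.
- by rewrite vstarD mulrDl linearD.
- by rewrite mulrDr linearD.
- by rewrite vstarZ -vscaleAl linearZ.
- by rewrite -vscaleAr linearZ.
Qed.

Lemma gns_mul phi x y z : gns phi (x * y) z = gns phi y (vstar x * z).
Proof. by rewrite /gns vstarM mulrA. Qed.

Lemma markov_traceC x y : markov_trace (x * y) = markov_trace (y * x).
Proof. by rewrite /markov_trace !lmulM optraceC. Qed.

End Calculus.

Lemma posroot_psdmx_eq (C : numClosedFieldType) n (A B : 'M[C]_n) k :
  (0 < k)%N -> psdmx B -> B ^+ k = A -> posroot (@psdmx C n) k A = B.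
Proof.
move=> k_gt0 B_pos def_A; apply: xget_unique => //= D [D_pos].
by rewrite -def_A => eq_BD; apply: psdmx_root_uniq eq_BD.
Qed.

(** * Roots of positive operators and the modular operator *)

Section OperatorRoots.
Variables (C : numClosedFieldType) (V : vectType C) (ip : V -> V -> C).
Hypothesis ip_inner : inner_product ip.
Local Notation n := (\dim {:V}).

Definition opmx (S : 'End(V)) : 'M[C]_n :=
  \matrix_(i, j) coord (vbasis {:V}) i (S (basisv j)).

Definition gram : 'M[C]_n := \matrix_(i, j) ip (basisv i) (basisv j).

Lemma opmx_inj : injective opmx.
Proof.
move=> S T eqST; apply/lfunP => x; rewrite (coord_basisv x) !linear_sum.
apply: eq_bigr => j _; rewrite !linearZ; congr (_ *: _).
rewrite [LHS]coord_basisv [RHS]coord_basisv; apply: eq_bigr => i _.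
by have /matrixP/(_ i j) := eqST; rewrite !mxE => ->.
Qed.

Lemma opmx_comp S T : opmx (S \o T)%VF = opmx S *m opmx T.
Proof.
apply/matrixP => i j; rewrite !mxE comp_lfunE {1}(coord_basisv (T (basisv j))).
rewrite !linear_sum; apply: eq_bigr => l _; by rewrite !linearZ !mxE mulrC.
Qed.

Lemma opmx1 : opmx \1%VF = 1%:M.
Proof. by apply/matrixP => i j; rewrite !mxE id_lfunE coord_basisvE. Qed.

Lemma opmx_iter S k : opmx (iter k (comp_lfun S) \1%VF) = opmx S ^+ k.
Proof.
elim: k => [|k IHk]; first by rewrite opmx1 expr0.
by rewrite iterS opmx_comp IHk exprS.
Qed.

Lemma dotcv_gram S (xi : 'cV[C]_n) (x := \sum_i xi i 0 *: basisv i) :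
  dotcv xi (gram *m opmx S *m xi) = ip x (S x).
Proof.
have [ses _ _] := ip_inner; have [_ _ ipZl ipZr] := ses.
rewrite dotcvE (sesquilinear_suml ses); apply: eq_bigr => i _.
rewrite ipZl; congr (_ * _); rewrite /x linear_sum (sesquilinear_sumr ses) mxE.
apply: eq_bigr => j _; rewrite linearZ ipZr mulrC; congr (_ * _).
rewrite mxE /= [in RHS](coord_basisv (S (basisv j))) (sesquilinear_sumr ses).
by apply: eq_bigr => l _; rewrite ipZr !mxE mulrC.
Qed.

(** Conjugation by a square root P of the Gram matrix passes to an orthonormal
basis, in which positivity is that of matrices. *)
Lemma opmx_conj_psd S P : P \in unitmx -> psdmx P -> P *m P = gram ->
  oppos ip S -> psdmx (P *m opmx S *m invmx P).
Proof.
move=> P_unit P_psd PP S_pos eta.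
rewrite -[X in dotcv X](mulKVmx P_unit) -{2}(mulKVmx P_unit eta).
move: (invmx P *m eta) => xi; rewrite -!mulmxA mulKmx //.
by rewrite -{1}(psdmx_herm P_psd) -dotcv_adj !mulmxA PP dotcv_gram.
Qed.

Lemma oproot_eq k S T : (0 < k)%N ->
  oppos ip S -> iter k (comp_lfun S) \1%VF = T -> oproot ip k T = S.
Proof.
move=> k_gt0 S_pos def_T; have [ses ge0 def] := ip_inner.
have gram_psd : psdmx gram.
  by move=> xi; rewrite -[gram]mulmx1 -opmx1 dotcv_gram id_lfunE.
have [p P_psd PP] := psdmx_root_exists (isT : (0 < 2)%N) gram_psd.
move: (\sum_j _) P_psd PP => P P_psd; rewrite expr2 => PP.
have P_unit : P \in unitmx.
  apply: injective_unitmx => xi Pxi0.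
  have : dotcv xi (gram *m opmx \1%VF *m xi) = 0.
    rewrite opmx1 mulmx1 -PP -mulmxA Pxi0 mulmx0 dotcvE big1 // => i _.
    by rewrite mxE mulr0.
  rewrite dotcv_gram id_lfunE => /def x0; apply/colP => i; rewrite mxE.
  have := congr1 (coord (vbasis {:V}) i) x0; rewrite linear0 linear_sum /=.
  rewrite (bigD1 i) //= big1 => [|j /negPf ji]; rewrite linearZ /= coord_basisvE.
    by rewrite eqxx mulr1 addr0.
  by rewrite eq_sym ji mulr0.
apply: xget_unique => //= S' [S'_pos def_S']; apply: opmx_inj.
have conj_pow U j : (P *m opmx U *m invmx P) ^+ j = P *m opmx U ^+ j *m invmx P.
  elim: j => [|j IHj]; first by rewrite !expr0 mulmx1 mulmxV.
  by rewrite !exprS IHj -[_ * _]/(_ *m _) !mulmxA mulmxKV.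
have : P *m opmx S' *m invmx P = P *m opmx S *m invmx P.
  apply: (psdmx_root_uniq k_gt0); [exact: opmx_conj_psd | exact: opmx_conj_psd |].
  by rewrite !conj_pow -!opmx_iter def_S' def_T.
by move=> /(congr1 (fun X => invmx P *m (X *m P))); rewrite !mulmxKV // !mulKmx.
Qed.

End OperatorRoots.

Section Modular.
Variables (C : numClosedFieldType) (M : vNalg C) (phi : {scalar elt M}).
Hypothesis phi_fp : faithful_positive phi.

Lemma modularE (a x : elt M) : modular a x = a * x * ringinv a.
Proof.
by rewrite /modular linfunE // => c u v;
  rewrite mulrDr mulrDl -vscaleAr -vscaleAl.
Qed.

(** For y = x this is the positivity of the modular operator of g ^ 2; it follows
from the tracial property of Tr_M. *)
Lemma gns_modular (Q g x y : elt M) :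
  (forall z, phi z = markov_trace (Q * z)) -> vpos g -> invertible g ->
  g * Q = Q * g ->
  gns phi y (modular (g ^+ 2) x) = gns phi (modular g y) (modular g x).
Proof.
move=> phiE g_pos g_inv gQ; have [ggi gig] := ringinvP g_inv.
have gi_herm := vpos_herm (vpos_ringinv g_pos g_inv).
have -> : modular (g ^+ 2) x = modular g (modular g x).
  by rewrite !modularE ringinvX // !expr2 !mulrA.
rewrite /gns !phiE [modular g y]modularE (modularE g (modular g x)).
rewrite !vstarM gi_herm (vpos_herm g_pos).
have giQ : ringinv g * Q = Q * ringinv g.
  by rewrite -[LHS]mulr1 -ggi !mulrA -(mulrA _ Q g) -gQ !mulrA gig mul1r.
by rewrite !mulrA [LHS](markov_traceC _ (ringinv g)) !mulrA giQ.
Qed.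

Lemma oproot_modular (Q : elt M) : is_density phi Q ->
  oproot (gns phi) 4 (modular Q) = modular (posroot (@vpos C M) 4 Q).
Proof.
move=> [Q_pos Q_inv phiE].
have [h_pos hQ] := posrootP (isT : (0 < 4)%N) Q_pos.
move: (posroot _ _ _) h_pos hQ => h h_pos hQ.
(* Positivity of x |-> h x h^-1 comes from the square root g of h. *)
have [g_pos gh] := posrootP (isT : (0 < 2)%N) h_pos.
move: (posroot _ _ _) g_pos gh => g g_pos gh.
have h_inv : invertible h by apply: (@invertible_root _ h 3); rewrite hQ.
have g_inv : invertible g by apply: (@invertible_root _ g 1); rewrite gh.
apply: (oproot_eq (gns_inner phi_fp)) => //.
  move=> x; rewrite -gh (gns_modular _ _ phiE) //.
    by case: (gns_inner phi_fp).
  by rewrite -hQ -gh -exprM -exprS -exprSr.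
apply/lfunP => x; rewrite !comp_lfunE id_lfunE !modularE -hQ ringinvX //.
by rewrite !exprS !expr0 !mulr1 !mulrA.
Qed.

End Modular.

(** * Matrix units *)

Section Blocks.
Variables (C : numClosedFieldType) (N : vNalg C) (D : blocks N).
Implicit Types (x y : elt N) (al be : blk D).

Lemma bproj_inj x y : (forall al : blk D, bproj al x = bproj al y) -> x = y.
Proof.
move=> eq_xy; have [z [_ z_uniq]] := bproj_bij (fun al : blk D => bproj al x).
by rewrite -(z_uniq x) // -(z_uniq y).
Qed.

Lemma bproj1 al : bproj al 1 = 1%:M.
Proof.
have [z [z1 _]] := bproj_bij (fun al : blk D => 1%:M : 'M[C]_(bsize al)).
by rewrite -[LHS]mulmx1 -(z1 al) -bprojM mul1r.
Qed.

Lemma bincl_spec al (m : 'M[C]_(bsize al)) :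
  bproj al (bincl m) = m /\ forall be, be != al -> bproj be (bincl m) = 0.
Proof.
apply: (@xgetPex _ 0 [set x : elt N | bproj al x = m /\
    forall be : blk D, be != al -> bproj be x = 0]%classic).
pose f be : 'M[C]_(bsize be) :=
  if al =P be is ReflectT eq_ab then castmx (congr1 _ eq_ab, congr1 _ eq_ab) m
  else 0.
have [z [z_f _]] := bproj_bij f.
exists z; split=> [|be be_al]; rewrite z_f /f; case: eqP => // eq_ab.
  by apply/matrixP => i j; rewrite castmxE; congr (m _ _); apply: val_inj.
by rewrite -eq_ab eqxx in be_al.
Qed.

Lemma bproj_bincl al (m : 'M[C]_(bsize al)) : bproj al (bincl m) = m.
Proof. by have [] := bincl_spec m. Qed.

Lemma bproj_bincl_ne al be (m : 'M[C]_(bsize al)) :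
  be != al -> bproj be (bincl m) = 0.
Proof. by have [_] := bincl_spec m; apply. Qed.

Lemma bincl_eq al (m : 'M[C]_(bsize al)) x : bproj al x = m ->
  (forall be, be != al -> bproj be x = 0) -> x = bincl m.
Proof.
move=> xm x0; apply: bproj_inj => be; have [->|ne] := eqVneq be al.
  by rewrite bproj_bincl.
by rewrite bproj_bincl_ne ?x0.
Qed.

Lemma bincl_mull al (m : 'M[C]_(bsize al)) x :
  x * bincl m = bincl (bproj al x *m m).
Proof.
apply: bincl_eq => [|be ne]; first by rewrite bprojM bproj_bincl.
by rewrite bprojM bproj_bincl_ne ?mulmx0.
Qed.

Lemma bincl_mulr al (m : 'M[C]_(bsize al)) x :
  bincl m * x = bincl (m *m bproj al x).
Proof.
apply: bincl_eq => [|be ne]; first by rewrite bprojM bproj_bincl.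
by rewrite bprojM bproj_bincl_ne ?mul0mx.
Qed.

Lemma bincl_linear al : linear (@bincl C N D al).
Proof.
move=> a m m'; symmetry; apply: bincl_eq => [|be ne].
  by rewrite linearP /= !bproj_bincl.
by rewrite linearP /= !bproj_bincl_ne // scaler0 addr0.
Qed.

HB.instance Definition _ al :=
  GRing.isLinear.Build C 'M[C]_(bsize al) (elt N) _ (@bincl C N D al)
    (@bincl_linear al).

Lemma vstar_bincl al (m : 'M[C]_(bsize al)) :
  vstar (bincl m) = bincl (adjmx m).
Proof.
apply: bincl_eq => [|be ne]; first by rewrite bproj_star bproj_bincl.
by rewrite bproj_star bproj_bincl_ne // /adjmx trmx0 map_mx0.
Qed.

Lemma bincl_sum x : x = \sum_(al : blk D) bincl (bproj al x).
Proof.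
apply: bproj_inj => al; rewrite linear_sum (bigD1 al) //= bproj_bincl.
by rewrite big1 ?addr0 // => be ne; rewrite bproj_bincl_ne // eq_sym.
Qed.

Lemma bunit_sum : \sum_(al : blk D) bunit al = 1.
Proof. by rewrite [RHS]bincl_sum; apply: eq_bigr => al _; rewrite bproj1. Qed.

(** A component of a positive element is positive and a *-homomorphism preserves
roots, so the root of a component is the component of the root. *)
Lemma invmx_posroot_bproj al x y : vpos x -> invertible x -> x ^+ 4 = y ->
  invmx (posroot (@psdmx C _) 2 (bproj al y)) =
  bproj al (ringinv x) *m bproj al (ringinv x).
Proof.
move=> x_pos x_inv def_y.
rewrite (@posroot_psdmx_eq _ _ _ (bproj al (x ^+ 2))) //.
- have xx : bproj al (x ^+ 2) *m bproj al (ringinv x ^+ 2) = 1%:M.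
    rewrite -bprojM -ringinvX // -(bproj1 al).
    by have [-> _] := ringinvP (invertible_exp 2 x_inv).
  have [x2_unit _] := mulmx1_unit xx.
  by rewrite -bprojM -expr2 -[RHS](mulKmx x2_unit) xx mulmx1.
- by rewrite expr2 bprojM -{1}(vpos_herm x_pos) bproj_star; apply: psdmx_gram.
- by rewrite expr2 -[_ * _]/(_ *m _) -bprojM -expr2 -exprM def_y.
Qed.

(** The matrix unit e_ij of the block al. *)
Definition munit al (i j : 'I_(bsize al)) : elt N := bincl (delta_mx i j).

Lemma munit_mul al (i j k l : 'I_(bsize al)) :
  munit i j * munit k l = munit i l *+ (j == k).
Proof.
rewrite /munit bincl_mull bproj_bincl mul_delta_mx_cond.
by case: (j == k); rewrite ?mulr1n // !mulr0n linear0.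
Qed.

Lemma vstar_munit al (i j : 'I_(bsize al)) : vstar (munit i j) = munit j i.
Proof. by rewrite /munit vstar_bincl adjmx_delta. Qed.

Lemma bincl_munit al (m : 'M[C]_(bsize al)) :
  bincl m = \sum_i \sum_j m i j *: munit i j.
Proof.
rewrite {1}(matrix_sum_delta m) linear_sum; apply: eq_bigr => i _.
by rewrite linear_sum; apply: eq_bigr => j _; rewrite linearZ.
Qed.

Lemma munit_sum x :
  x = \sum_(al : blk D) \sum_i \sum_j bproj al x i j *: munit i j.
Proof. by rewrite {1}(bincl_sum x); apply: eq_bigr => al _; rewrite bincl_munit. Qed.

(** * The Markov trace *)

(** The trace of left multiplication, in the basis of matrix units: the entry (i, j)
of x e_ij is x_ii, and j takes n(alpha) values. *)
Lemma markov_trace_blocks x :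
  markov_trace x = \sum_(al : blk D) (bsize al)%:R * \tr (bproj al x).
Proof.
pose J al := ('I_(bsize al) * 'I_(bsize al))%type.
pose coef (p : {al : blk D & J al}) y := bproj (tag p) y (tagged p).1 (tagged p).2.
pose unit (p : {al : blk D & J al}) := munit (tagged p).1 (tagged p).2.
rewrite /markov_trace (@optrace_dual_basis _ _ _ unit coef).
- rewrite -(@sig_big_dep _ _ _ _ J predT (fun _ => predT)
     (fun al q => coef (Tagged J q) (lmul x (unit (Tagged J q))))) /=.
  apply: eq_bigr => al _; rewrite /coef /unit /= -(pair_bigA _
    (fun i j => bproj al (lmul x (munit i j)) i j)) /=.
  rewrite mulr_sumr; apply: eq_bigr => i _.
  rewrite (eq_bigr (fun=> bproj al x i i)) => [|j _].
    by rewrite sumr_const card_ord mulr_natl.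
  rewrite lmulE bincl_mull bproj_bincl mxE (bigD1 i) //= mxE !eqxx mulr1.
  by rewrite big1 ?addr0 // => l /negPf ne; rewrite mxE ne mulr0.
- by move=> p a u v; rewrite /coef linearP !mxE.
- move=> y; rewrite {1}(munit_sum y).
  rewrite -(@sig_big_dep _ _ _ _ J predT (fun _ => predT)
     (fun al q => coef (Tagged J q) y *: unit (Tagged J q))) /=.
  by apply: eq_bigr => al _; rewrite pair_bigA.
Qed.

End Blocks.

(** * The tensor square of the GNS space *)

Section Tensors.
Variable C : numClosedFieldType.
Implicit Types V W U : vectType C.

Lemma tpure_linearl V W (y : W) : linear (fun x : V => tpure x y).
Proof. by move=> a u v; apply/matrixP => i j; rewrite !mxE linearP /=; ring. Qed.

Lemma tpure_linearr V W (x : V) : linear (fun y : W => tpure x y).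
Proof. by move=> a u v; apply/matrixP => i j; rewrite !mxE linearP /=; ring. Qed.

Lemma tliftE V W U (f : V -> W -> U) (T : 'M_(_, _)) :
  tlift f T = \sum_i \sum_j T i j *: f (basisv i) (basisv j).
Proof.
rewrite /tlift linfunE // => a S S'.
rewrite scaler_sumr -big_split; apply: eq_bigr => i _ /=.
rewrite scaler_sumr -big_split; apply: eq_bigr => j _ /=.
by rewrite !mxE scalerDl scalerA.
Qed.

Lemma tlift_pure V W U (f : V -> W -> U) x y :
  (forall y', linear (f^~ y')) -> (forall x', linear (f x')) ->
  tlift f (tpure x y) = f x y.
Proof.
move=> f_linl f_linr; rewrite tliftE.
pose F y' : {linear V -> U} :=
  HB.pack (f^~ y') (GRing.isLinear.Build _ _ _ _ (f^~ y') (f_linl y')).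
pose G x' : {linear W -> U} :=
  HB.pack (f x') (GRing.isLinear.Build _ _ _ _ (f x') (f_linr x')).
transitivity (F y x) => //; rewrite (coord_basisv x) linear_sum.
apply: eq_bigr => i _; rewrite linearZ /=.
transitivity (coord (vbasis {:V}) i x *: G (basisv i) y) => //.
rewrite [y in RHS]coord_basisv linear_sum scaler_sumr; apply: eq_bigr => j _.
by rewrite linearZ !mxE scalerA -coord_basisv.
Qed.

Section TensorInner.
Variables (V W : vectType C) (ipV : V -> V -> C) (ipW : W -> W -> C).
Hypotheses (sesV : sesquilinear_form ipV) (sesW : sesquilinear_form ipW).

Lemma tip_sesqui : sesquilinear_form (tip ipV ipW).
Proof.
by split=> *; rewrite /tip ?mulr_sumr -?big_split; apply: eq_bigr => i _ /=;
  rewrite ?mulr_sumr -?big_split; apply: eq_bigr => j _ /=;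
  rewrite ?mulr_sumr -?big_split; apply: eq_bigr => k _ /=;
  rewrite ?mulr_sumr -?big_split; apply: eq_bigr => l _ /=;
  rewrite !mxE ?rmorphD ?rmorphM /=; ring.
Qed.

Lemma tip_pure T x y : tip ipV ipW T (tpure x y) =
  \sum_i \sum_j Num.conj (T i j) * (ipV (basisv i) x * ipW (basisv j) y).
Proof.
have [_ _ _ ipVZr] := sesV; have [_ _ _ ipWZr] := sesW.
apply: eq_bigr => i _; apply: eq_bigr => j _.
rewrite [x in RHS]coord_basisv [y in RHS]coord_basisv.
rewrite (sesquilinear_sumr sesV) (sesquilinear_sumr sesW) mulr_suml mulr_sumr.
apply: eq_bigr => k _; rewrite !mulr_sumr; apply: eq_bigr => l _.
by rewrite ipVZr ipWZr !mxE -/(basisv _); ring.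
Qed.

Lemma tip_nondeg : nondegenerate_form ipV -> nondegenerate_form ipW ->
  nondegenerate_form (tip ipV ipW).
Proof.
move=> ndV ndW T T0; have [_ _ _ ipVZr] := sesV; have [_ _ _ ipWZr] := sesW.
have basis0 U (c : 'I_(\dim {:U}) -> C) :
    \sum_k c k *: basisv k = 0 :> U -> forall k, c k = 0.
  move=> c0 k; have := congr1 (coord (vbasis {:U}) k) c0.
  rewrite linear0 linear_sum (bigD1 k) //= big1 => [|j /negPf jk].
    by rewrite linearZ /= coord_basisvE eqxx mulr1 addr0.
  by rewrite linearZ /= coord_basisvE eq_sym jk mulr0.
have extV z : (forall i, ipV (basisv i) z = 0) -> z = 0.
  move=> z0; apply: ndV => x; rewrite (coord_basisv x) (sesquilinear_suml sesV).
  by rewrite big1 // => i _; case: sesV => _ _ -> _; rewrite z0 mulr0.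
have extW z : (forall i, ipW (basisv i) z = 0) -> z = 0.
  move=> z0; apply: ndW => x; rewrite (coord_basisv x) (sesquilinear_suml sesW).
  by rewrite big1 // => i _; case: sesW => _ _ -> _; rewrite z0 mulr0.
have row0 j k : \sum_l T k l * ipW (basisv j) (basisv l) = 0.
  move: k; apply: basis0; apply: extV => i.
  have := T0 (delta_mx i j); rewrite /tip (bigD1 i) //= [X in _ + X]big1 ?addr0; last first.
    move=> i' /negPf ne; rewrite big1 // => j' _; rewrite big1 // => k _.
    by rewrite big1 // => l _; rewrite mxE ne conjC0 !mul0r.
  rewrite (bigD1 j) //= [X in _ + X]big1 ?addr0; last first.
    move=> j' /negPf ne; rewrite big1 // => k _; rewrite big1 // => l _.
    by rewrite mxE ne andbF conjC0 !mul0r.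
  move=> eq0; rewrite -[RHS]eq0 (sesquilinear_sumr sesV); apply: eq_bigr => k _.
  rewrite ipVZr mulr_suml; apply: eq_bigr => l _.
  by rewrite mxE !eqxx conjC1 mul1r -!/(basisv _); ring.
apply/matrixP => k l; rewrite mxE; move: l; apply: basis0; apply: extW => j.
rewrite (sesquilinear_sumr sesW) -[RHS](row0 j k); apply: eq_bigr => l _.
by rewrite ipWZr.
Qed.

End TensorInner.
End Tensors.

Lemma mult_pure (C : numClosedFieldType) (M : vNalg C) (x y : elt M) :
  mult M (tpure x y) = x * y.
Proof.
rewrite /mult tlift_pure // => z a u v.
  by rewrite mulrDl vscaleAl.
by rewrite mulrDr vscaleAr.
Qed.

Lemma mult_tmap_pure (C : numClosedFieldType) (N M : vNalg C)
    (A B : 'Hom(elt N, elt M)) x y :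
  mult M (tmap A B (tpure x y)) = A x * B y.
Proof.
rewrite /tmap tlift_pure ?mult_pure // => z a u v.
  by rewrite linearP tpure_linearl.
by rewrite linearP tpure_linearr.
Qed.

(** * The adjoint of the multiplication *)

Section MultAdjoint.
Variables (C : numClosedFieldType) (N : vNalg C) (D : blocks N).
Variables (phi : {scalar elt N}) (Q : elt N).
Hypotheses (phi_fp : faithful_positive phi) (Q_density : is_density phi Q).

(** The adjoint of the multiplication, by [adjoint_mult]. *)
Definition mult_adj : 'Hom(elt N, 'M[C]_(\dim {: elt N}, \dim {: elt N})) :=
  linfun (fun x : elt N => \sum_(al : blk D) (bsize al)%:R^-1 *:
    \sum_i \sum_j tpure (x * munit i j) (ringinv Q * munit (al := al) j i)).

Lemma mult_adjE x : mult_adj x = \sum_(al : blk D) (bsize al)%:R^-1 *: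
    \sum_i \sum_j tpure (x * munit i j) (ringinv Q * munit (al := al) j i).
Proof.
rewrite /mult_adj linfunE // => a u v.
rewrite scaler_sumr -big_split; apply: eq_bigr => al _ /=.
rewrite scalerA mulrC -scalerA -scalerDr; congr (_ *: _).
rewrite scaler_sumr -big_split; apply: eq_bigr => i _ /=.
rewrite scaler_sumr -big_split; apply: eq_bigr => j _ /=.
by rewrite mulrDl -vscaleAl tpure_linearl.
Qed.

Lemma density_munit w (al : blk D) (i j : 'I_(bsize al)) :
  phi (w * munit i j) = (bsize al)%:R * bproj al (Q * w) j i.
Proof.
have [_ _ ->] := Q_density; rewrite mulrA (markov_trace_blocks D).
rewrite (bigD1 al) //= [X in _ + X]big1 ?addr0 => [|be ne]; last first.
  by rewrite bprojM bproj_bincl_ne // mulmx0 mxtrace0 mulr0.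
rewrite bprojM bproj_bincl; congr (_ * _).
rewrite /mxtrace (bigD1 j) //= big1 ?addr0 => [|l ne].
  rewrite mxE (bigD1 i) //= mxE !eqxx mulr1 big1 ?addr0 // => l /negPf ne.
  by rewrite mxE ne mulr0.
by rewrite mxE big1 // => m _; rewrite mxE (negPf ne) andbF mulr0.
Qed.

(** By [density_munit] the right side is, up to n(alpha), the trace of the block of
(Q w) (Q z Q^-1). This identity expresses the adjointness of [mult_adj] and the
multiplication. *)
Lemma density_mul z w : phi (z * w) =
  \sum_(al : blk D) (bsize al)%:R^-1 *
    \sum_i \sum_j phi (w * munit i j) * phi (z * (ringinv Q * munit (al := al) j i)).
Proof.
have [_ Q_inv phiE] := Q_density; have [QQi QiQ] := ringinvP Q_inv.
have -> : phi (z * w) = markov_trace (Q * w * (Q * z * ringinv Q)).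
  by rewrite markov_traceC phiE !mulrA -(mulrA _ (ringinv Q)) QiQ mulr1.
rewrite (markov_trace_blocks D); apply: eq_bigr => al _.
have n_neq0 : (bsize al)%:R != 0 :> C by rewrite pnatr_eq0 -lt0n bsize_gt0.
rewrite bprojM /mxtrace mulr_sumr exchange_big mulr_sumr.
apply: eq_bigr => i _; rewrite mxE !mulr_sumr; apply: eq_bigr => j _.
rewrite (mulrA z) !density_munit (mulrA Q z) mulrACA.
by rewrite !mulrA mulVf // mul1r.
Qed.

Lemma adjoint_mult :
  adjoint (tip (gns phi) (gns phi)) (gns phi) (mult N) = mult_adj.
Proof.
have [ses ge0 def] := gns_inner phi_fp.
have nd := inner_product_nondeg (gns_inner phi_fp).
have tses := tip_sesqui (gns phi) (gns phi).
apply: adjoint_eq => //; first exact: tip_nondeg.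
move=> T y; rewrite mult_adjE (sesquilinear_sumr tses).
have [_ _ gZl _] := ses; have [_ _ _ tZr] := tses.
transitivity (\sum_i \sum_j Num.conj (T i j) * gns phi (basisv i * basisv j) y).
  rewrite /mult tliftE (sesquilinear_suml ses); apply: eq_bigr => i _.
  by rewrite (sesquilinear_suml ses); apply: eq_bigr => j _; rewrite gZl.
rewrite (eq_bigr (fun al : blk D => \sum_i \sum_j Num.conj (T i j) *
  ((bsize al)%:R^-1 * \sum_a \sum_b gns phi (basisv i) (y * munit a b) *
     gns phi (basisv j) (ringinv Q * munit (al := al) b a)))) => [|al _]; last first.
  rewrite tZr (sesquilinear_sumr tses) mulr_sumr.
  transitivity (\sum_a \sum_b \sum_i \sum_j (bsize al)%:R^-1 * (Num.conj (T i j) *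
     (gns phi (basisv i) (y * munit a b) *
     gns phi (basisv j) (ringinv Q * munit (al := al) b a)))).
    apply: eq_bigr => a _; rewrite (sesquilinear_sumr tses) mulr_sumr.
    apply: eq_bigr => b _; rewrite (tip_pure ses ses) mulr_sumr.
    by apply: eq_bigr => i _; rewrite mulr_sumr.
  rewrite (eq_bigr _ (fun a _ => exchange_big _ _ _ _ _ _)) exchange_big.
  apply: eq_bigr => i _.
  rewrite (eq_bigr _ (fun a _ => exchange_big _ _ _ _ _ _)) exchange_big.
  apply: eq_bigr => j _; rewrite !mulr_sumr; apply: eq_bigr => a _.
  by rewrite !mulr_sumr; apply: eq_bigr => b _; rewrite mulrCA.
rewrite [RHS]exchange_big; apply: eq_bigr => i _; rewrite [RHS]exchange_big.
apply: eq_bigr => j _; rewrite -mulr_sumr; congr (_ * _).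
rewrite /gns vstarM -mulrA density_mul; apply: eq_bigr => al _.
by congr (_ * _); apply: eq_bigr => a _; apply: eq_bigr => b _; rewrite !mulrA.
Qed.

Lemma schurE (M : vNalg C) (A B : 'Hom(elt N, elt M)) x :
  schur phi A B x = \sum_(al : blk D) (bsize al)%:R^-1 *:
    \sum_i \sum_j A (x * munit i j) * B (ringinv Q * munit (al := al) j i).
Proof.
rewrite /schur adjoint_mult !comp_lfunE mult_adjE !linear_sum.
apply: eq_bigr => al _; rewrite !linearZ; congr (_ *: _) => /=.
rewrite !linear_sum; apply: eq_bigr => i _; rewrite !linear_sum.
by apply: eq_bigr => j _; rewrite /= mult_tmap_pure.
Qed.

End MultAdjoint.

(** * Invariance of the Casimir element *)

Section Casimir.
Variables (C : numClosedFieldType) (N : vNalg C) (D : blocks N) (al : blk D).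
Variables (V : lmodType C) (f : elt N -> elt N -> V).
Hypotheses (f_linl : forall v, linear (f^~ v)) (f_linr : forall u, linear (f u)).
Local Notation e := (munit (al := al)).

Let f_suml (I : finType) (c : I -> C) (u : I -> elt N) v :
  f (\sum_i c i *: u i) v = \sum_i c i *: f (u i) v.
Proof.
pose F : {linear elt N -> V} :=
  HB.pack (f^~ v) (GRing.isLinear.Build _ _ _ _ (f^~ v) (f_linl v)).
transitivity (F (\sum_i c i *: u i)) => //; rewrite linear_sum.
by apply: eq_bigr => i _; rewrite linearZ.
Qed.

Let f_sumr (I : finType) (c : I -> C) u (v : I -> elt N) :
  f u (\sum_i c i *: v i) = \sum_i c i *: f u (v i).
Proof.
pose F : {linear elt N -> V} :=
  HB.pack (f u) (GRing.isLinear.Build _ _ _ _ (f u) (f_linr u)).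
transitivity (F (\sum_i c i *: v i)) => //; rewrite linear_sum.
by apply: eq_bigr => i _; rewrite linearZ.
Qed.

Lemma munit_mull x i j : x * e i j = \sum_k bproj al x k i *: e k j.
Proof.
rewrite bincl_mull bincl_munit; apply: eq_bigr => k _.
rewrite (bigD1 j) //= big1 ?addr0 => [|l ne].
  rewrite mxE (bigD1 i) //= big1 ?addr0 => [|m ne]; rewrite mxE ?eqxx ?mulr1 //.
  by rewrite (negPf ne) mulr0.
rewrite mxE big1 ?scale0r // => m _.
by rewrite mxE (negPf ne) andbF mulr0.
Qed.

Lemma munit_mulr x i j : e i j * x = \sum_k bproj al x j k *: e i k.
Proof.
rewrite bincl_mulr bincl_munit exchange_big; apply: eq_bigr => k _ /=.
rewrite (bigD1 i) //= big1 ?addr0 => [|l ne].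
  rewrite mxE (bigD1 j) //= big1 ?addr0 => [|m ne]; rewrite mxE ?eqxx ?mul1r //.
  by rewrite (negPf ne) andbF mul0r.
rewrite mxE big1 ?scale0r // => m _.
by rewrite mxE (negPf ne) mul0r.
Qed.

Lemma casimir_outer x :
  \sum_i \sum_j f (x * e i j) (e j i) = \sum_i \sum_j f (e i j) (e j i * x).
Proof.
transitivity (\sum_i \sum_j \sum_k bproj al x k i *: f (e k j) (e j i)).
  by apply: eq_bigr => i _; apply: eq_bigr => j _; rewrite munit_mull f_suml.
transitivity (\sum_i \sum_j \sum_k bproj al x i k *: f (e i j) (e j k)).
  rewrite exchange_big [RHS]exchange_big; apply: eq_bigr => j _.
  by rewrite exchange_big.
by apply: eq_bigr => i _; apply: eq_bigr => j _; rewrite munit_mulr f_sumr.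
Qed.

Lemma casimir_inner y :
  \sum_i \sum_j f (e i j * y) (e j i) = \sum_i \sum_j f (e i j) (y * e j i).
Proof.
transitivity (\sum_i \sum_j \sum_k bproj al y j k *: f (e i k) (e j i)).
  by apply: eq_bigr => i _; apply: eq_bigr => j _; rewrite munit_mulr f_suml.
transitivity (\sum_i \sum_j \sum_k bproj al y k j *: f (e i j) (e k i)).
  by apply: eq_bigr => i _; rewrite exchange_big.
by apply: eq_bigr => i _; apply: eq_bigr => j _; rewrite munit_mull f_sumr.
Qed.

End Casimir.

(** * Positivity of functionals and of *-homomorphisms *)

Section Positivity.
Variables (C : numClosedFieldType) (M : vNalg C) (phi : {scalar elt M}).
Hypothesis phi_fp : faithful_positive phi.

Lemma functional_vpos (a : elt M) : vpos a -> 0 <= phi a /\ (phi a = 0 -> a = 0).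
Proof.
move=> a_pos; have [b_pos def_a] := posrootP (isT : (0 < 2)%N) a_pos.
move: (posroot _ _ _) b_pos def_a => b /vpos_herm b_herm <-.
have [phi_ge0 phi_def] := phi_fp; rewrite expr2 -{1 3}b_herm; split=> //.
by move=> /phi_def ->; rewrite mulr0.
Qed.

End Positivity.

Section CompletePositivity.
Variables (C : numClosedFieldType) (N M : vNalg C) (D : blocks N).

Lemma ampl_pos_conj (P : vNalg C) k (x : 'I_k -> 'I_k -> elt P) c :
  ampl_pos x -> ampl_pos (fun i j => vstar c * x i j * c).
Proof.
move=> x_pos xi; have := x_pos (fun i => opval c *m xi i).
congr (0 <= _); apply: eq_bigr => i _; apply: eq_bigr => j _.
by rewrite !opvalM opval_star -!mulmxA [RHS]dotcv_adj adjmxK.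
Qed.

(** The matrix with entries bproj al (x i j) a b is obtained by testing x on the
vectors sum_a w_ia e_ao zeta, for a nonzero vector zeta = e_oo zeta. *)
Lemma ampl_pos_block k (x : 'I_k -> 'I_k -> elt N) (al : blk D)
    (w : 'I_k -> 'I_(bsize al) -> C) : ampl_pos x ->
  0 <= \sum_i \sum_j \sum_a \sum_b Num.conj (w i a) * bproj al (x i j) a b * w j b.
Proof.
move=> x_pos; have [dDl dDr dZl dZr] := dotcv_sesqui C (vN_dim N).
have ses := dotcv_sesqui C (vN_dim N).
pose o : 'I_(bsize al) := Ordinal (bsize_gt0 al).
have [z z_neq0] : exists z : 'cV[C]_(vN_dim N), opval (munit o o) *m z != 0.
  apply: contrapT => z0; have : munit o o = 0.
    apply: opval_inj; apply/matrixP => i j.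
    have : opval (munit o o) *m (delta_mx j 0 : 'cV_ _) = 0.
      by apply/eqP/negPn/negP => nz; apply: z0; exists (delta_mx j 0).
    rewrite -colE => /colP/(_ i).
    by rewrite opval0 !mxE.
  move=> /(congr1 (bproj al)); rewrite bproj_bincl linear0 => /matrixP/(_ o o).
  by rewrite !mxE !eqxx => /eqP; rewrite oner_eq0.
set zeta := _ *m z in z_neq0.
have e00 : opval (munit o o) *m zeta = zeta.
  by rewrite mulmxA -opvalM munit_mul eqxx mulr1n.
move: zeta z_neq0 e00 => zeta zeta_neq0 e00.
have zz_gt0 : 0 < dotcv zeta zeta.
  by rewrite lt_def dotcv_ge0 andbT; apply: contraNneq zeta_neq0 => /dotcv_eq0->.
rewrite -(pmulr_rge0 _ zz_gt0).
have := x_pos (fun i => \sum_a w i a *: (opval (munit a o) *m zeta)).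
congr (0 <= _); rewrite mulr_sumr; apply: eq_bigr => i _.
rewrite mulr_sumr; apply: eq_bigr => j _.
rewrite (sesquilinear_suml ses) mulr_sumr; apply: eq_bigr => a _.
rewrite mulmx_sumr (sesquilinear_sumr ses) mulr_sumr; apply: eq_bigr => b _.
rewrite dZl -scalemxAr dZr.
rewrite -[X in dotcv (X *m _)]adjmxK -opval_star vstar_munit -dotcv_adj !mulmxA.
rewrite -!opvalM /munit bincl_mulr bincl_mull bproj_bincl.
have -> : delta_mx o a *m bproj al (x i j) *m delta_mx b o =
    bproj al (x i j) a b *: (delta_mx o o : 'M[C]_(bsize al)).
  by rewrite delta_mx_sandwich.
by rewrite linearZ /= -scalemxAl -[vsval _]/(opval (munit o o)) e00 dZr; ring.
Qed.

(** Since theta(e_ab) = theta(e_oa)^* theta(e_ob), the positive matrices of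
[ampl_pos_block] are contracted with the coordinates of the vectors
theta(e_oa) xi_i. *)
Lemma star_hom_cp (theta : 'Hom(elt N, elt M)) : star_hom theta ->
  completely_positive theta.
Proof.
move=> [thM thS] k x x_pos xi; have ses := dotcv_sesqui C (vN_dim M).
have [dDl dDr dZl dZr] := ses.
pose o (al : blk D) : 'I_(bsize al) := Ordinal (bsize_gt0 al).
pose eta (al : blk D) i a := opval (theta (munit (o al) a)) *m xi i.
suff -> : \sum_i \sum_j dotcv (xi i) (opval (theta (x i j)) *m xi j) =
    \sum_(al : blk D) \sum_c \sum_i \sum_j \sum_a \sum_b
      Num.conj (eta al i a c 0) * bproj al (x i j) a b * eta al j b c 0.
  by apply: sumr_ge0 => al _; apply: sumr_ge0 => c _; apply: ampl_pos_block.
transitivity (\sum_i \sum_j \sum_(al : blk D) \sum_a \sum_b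
    bproj al (x i j) a b * dotcv (eta al i a) (eta al j b)).
  apply: eq_bigr => i _; apply: eq_bigr => j _.
  rewrite {1}(munit_sum D (x i j)) linear_sum opval_sum mulmx_suml.
  rewrite (sesquilinear_sumr ses); apply: eq_bigr => al _.
  rewrite linear_sum opval_sum mulmx_suml.
  rewrite (sesquilinear_sumr ses); apply: eq_bigr => a _.
  rewrite linear_sum opval_sum mulmx_suml.
  rewrite (sesquilinear_sumr ses); apply: eq_bigr => b _.
  rewrite linearZ opvalZ -scalemxAl dZr; congr (_ * _).
  rewrite /eta -[X in dotcv (X *m _)]adjmxK -opval_star -thS vstar_munit -dotcv_adj.
  by rewrite mulmxA -opvalM -thM munit_mul eqxx mulr1n.
rewrite (eq_bigr _ (fun i _ => exchange_big _ _ _ _ _ _)) exchange_big.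
apply: eq_bigr => al _ /=; rewrite [RHS]exchange_big; apply: eq_bigr => i _ /=.
rewrite [RHS]exchange_big; apply: eq_bigr => j _ /=.
rewrite [RHS]exchange_big; apply: eq_bigr => a _ /=.
rewrite [RHS]exchange_big; apply: eq_bigr => b _ /=.
rewrite dotcvE mulr_sumr; apply: eq_bigr => c _; ring.
Qed.

End CompletePositivity.

(** * The element u *)

Section CornerInverse.
Variables (C : numClosedFieldType) (N M : vNalg C) (D : blocks N).
Variables (phi : {scalar elt M}) (phi_fp : faithful_positive phi).
Variables (theta : 'Hom(elt N, elt M)) (theta_hom : star_hom theta).
Variables (q : elt M) (r ri : elt N).
Hypotheses (q_herm : vstar q = q) (q_inv : invertible q).
Hypotheses (ri_herm : vstar ri = ri) (rri : r * ri = 1) (rir : ri * r = 1).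

Lemma star_homM x y : theta (x * y) = theta x * theta y.
Proof. by case: theta_hom. Qed.

Lemma star_hom_star x : theta (vstar x) = vstar (theta x).
Proof. by case: theta_hom. Qed.

Local Notation e1 := (theta 1).

Lemma theta1_mull x : e1 * theta x = theta x.
Proof. by rewrite -star_homM mul1r. Qed.

Lemma theta1_mulr x : theta x * e1 = theta x.
Proof. by rewrite -star_homM mulr1. Qed.

Definition sandwich (u v : elt N) : elt M := theta (u * ri) * q ^+ 2 * theta (ri * v).

(** The element a of the introduction. *)
Definition compression : elt M :=
  \sum_(al : blk D) (bsize al)%:R^-1 *:
    \sum_i \sum_j sandwich (munit i j) (munit (al := al) j i).

(** The complement 1 - theta(1) makes the element invertible in M; [corner_inv] is
the element u of the introduction. *)
Definition corner : elt M := compression + (1 - e1).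

Definition corner_inv : elt M := e1 * ringinv corner.

Lemma sandwich_linl v : linear (sandwich^~ v).
Proof.
move=> c x y; rewrite /sandwich mulrDl linearD /= !mulrDl -vscaleAl linearZ /=.
by rewrite !vscaleAl.
Qed.

Lemma sandwich_linr u : linear (sandwich u).
Proof.
move=> c x y; rewrite /sandwich mulrDr linearD /= !mulrDr -vscaleAr linearZ /=.
by rewrite !vscaleAr.
Qed.

Lemma sandwich_gram (al : blk D) (i j : 'I_(bsize al)) :
  sandwich (munit i j) (munit j i) =
  vstar (q * theta (ri * munit j i)) * (q * theta (ri * munit j i)).
Proof.
rewrite vstarM -star_hom_star vstarM vstar_munit ri_herm q_herm.
by rewrite /sandwich expr2 !mulrA.
Qed.

Lemma sum_scale_mull
    (F : forall al : blk D, 'I_(bsize al) -> 'I_(bsize al) -> elt M) z :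
  z * (\sum_al (bsize al)%:R^-1 *: \sum_i \sum_j F al i j) =
  \sum_al (bsize al)%:R^-1 *: \sum_i \sum_j z * F al i j.
Proof.
rewrite mulr_sumr; apply: eq_bigr => al _; rewrite -vscaleAr mulr_sumr.
by congr (_ *: _); apply: eq_bigr => i _; rewrite mulr_sumr.
Qed.

Lemma sum_scale_mulr
    (F : forall al : blk D, 'I_(bsize al) -> 'I_(bsize al) -> elt M) z :
  (\sum_al (bsize al)%:R^-1 *: \sum_i \sum_j F al i j) * z =
  \sum_al (bsize al)%:R^-1 *: \sum_i \sum_j F al i j * z.
Proof.
rewrite mulr_suml; apply: eq_bigr => al _; rewrite -vscaleAl mulr_suml.
by congr (_ *: _); apply: eq_bigr => i _; rewrite mulr_suml.
Qed.

Lemma compression_comm x : compression * theta x = theta x * compression.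
Proof.
rewrite sum_scale_mulr sum_scale_mull; apply: eq_bigr => al _; congr (_ *: _).
transitivity (\sum_i \sum_j sandwich (munit i j) (munit (al := al) j i * x)).
  apply: eq_bigr => i _; apply: eq_bigr => j _.
  by rewrite /sandwich -!mulrA -star_homM !mulrA.
rewrite -(casimir_outer _ sandwich_linl sandwich_linr).
apply: eq_bigr => i _; apply: eq_bigr => j _.
by rewrite /sandwich !mulrA -star_homM !mulrA.
Qed.

Lemma theta1_compression : e1 * compression = compression.
Proof.
rewrite sum_scale_mull; apply: eq_bigr => al _; congr (_ *: _).
apply: eq_bigr => i _; apply: eq_bigr => j _.
by rewrite /sandwich !mulrA theta1_mull.
Qed.

Lemma corner_comm x : corner * theta x = theta x * corner.
Proof.
rewrite mulrDl mulrDr compression_comm mulrBl mulrBr mul1r mulr1.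
by rewrite theta1_mull theta1_mulr.
Qed.

Lemma corner_theta1 : corner * e1 = compression.
Proof.
rewrite mulrDl compression_comm theta1_compression mulrBl mul1r.
by rewrite theta1_mull subrr addr0.
Qed.

Lemma inv_natr_ge0 (n : nat) : 0 <= n%:R^-1 :> C.
Proof. by rewrite invr_ge0 ler0n. Qed.

Lemma compression_vpos : vpos compression.
Proof.
apply: vpos_sum => al _; apply: vposZ; first exact: inv_natr_ge0.
apply: vpos_sum => i _; apply: vpos_sum => j _.
by rewrite sandwich_gram; apply: vpos_gram.
Qed.

Lemma theta1_compl_gram : 1 - e1 = vstar (1 - e1) * (1 - e1).
Proof.
have e1_herm : vstar e1 = e1 by rewrite -star_hom_star vstar1.
rewrite -[- e1]scaleN1r vstarD vstarZ e1_herm vstar1 rmorphN rmorph1 scaleN1r.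
by rewrite mulrBl !mulrBr !mul1r !mulr1 theta1_mull subrr subr0.
Qed.

Lemma corner_vpos : vpos corner.
Proof.
by apply: vposD compression_vpos _; rewrite theta1_compl_gram; apply: vpos_gram.
Qed.

(** The functional is faithful, so all the terms q theta(r^-1 e_ji) x of the sum of
squares vanish, and theta(e_ii) x = 0 for all i. *)
Lemma compression_eq0 x : compression * x = 0 -> e1 * x = 0.
Proof.
move=> cx0; have [q' [_ q'q]] := q_inv; have [phi_ge0 phi_def] := phi_fp.
have : phi (vstar x * (compression * x)) = 0 by rewrite cx0 mulr0 linear0.
rewrite sum_scale_mulr sum_scale_mull linear_sum => /eqP.
have term_ge0 (al : blk D) (i j : 'I_(bsize al)) :
    0 <= phi (vstar x * (sandwich (munit i j) (munit j i) * x)).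
  by rewrite sandwich_gram mulrA mulrA -vstarM -mulrA phi_ge0.
rewrite psumr_eq0 => [|al _]; last first.
  rewrite linearZ mulr_ge0 ?inv_natr_ge0 // linear_sum sumr_ge0 // => i _.
  by rewrite linear_sum sumr_ge0.
move=> /allP eq0; rewrite -(bunit_sum D) linear_sum mulr_suml big1 // => al _.
have := eq0 al (mem_index_enum al); rewrite /= linearZ mulf_eq0 invr_eq0 pnatr_eq0.
rewrite (negPf (lt0n_neq0 (bsize_gt0 al))) /= linear_sum psumr_eq0; last first.
  by move=> i _; rewrite linear_sum sumr_ge0.
move=> /allP eq0_al; have -> : bunit al = \sum_i munit (al := al) i i.
  by rewrite /bunit scalar_mx_sum_delta linear_sum; apply: eq_bigr => i _;
     rewrite scale1r.
rewrite linear_sum mulr_suml big1 // => i _.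
have := eq0_al i (mem_index_enum i); rewrite /= linear_sum psumr_eq0 //.
move=> /allP/(_ i (mem_index_enum i)) /= /eqP.
rewrite sandwich_gram mulrA mulrA -vstarM -mulrA => /phi_def.
rewrite -mulrA => /(congr1 (fun y => theta r * (q' * y))).
by rewrite !mulr0 (mulrA q' q) q'q mul1r mulrA -star_homM mulrA rri mul1r.
Qed.

Lemma corner_invertible : invertible corner.
Proof.
apply: injective_invertible => x; rewrite mulrDl => gx0.
have ex : e1 * (1 - e1) = 0 by rewrite mulrBr mulr1 theta1_mull subrr.
have cx0 : compression * x = 0.
  have := congr1 (fun y => e1 * y) gx0.
  by rewrite /= mulr0 mulrDr !mulrA ex mul0r addr0 theta1_compression.
move: gx0; rewrite cx0 add0r mulrBl mul1r compression_eq0 // subr0.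
by [].
Qed.

Lemma ringinv_corner_comm x : ringinv corner * theta x = theta x * ringinv corner.
Proof.
have [ggi gig] := ringinvP corner_invertible.
rewrite -[LHS]mulr1 -ggi mulrA -(mulrA _ (theta x)) -corner_comm !mulrA gig.
by rewrite mul1r.
Qed.

Lemma corner_inv_comm x : corner_inv * theta x = theta x * corner_inv.
Proof.
rewrite /corner_inv -mulrA ringinv_corner_comm !mulrA.
by rewrite theta1_mull theta1_mulr.
Qed.

Lemma corner_inv_vpos : vpos corner_inv.
Proof.
have gi_pos := vpos_ringinv corner_vpos corner_invertible.
have e1_herm : vstar e1 = e1 by rewrite -star_hom_star vstar1.
have := vpos_conj e1 gi_pos; rewrite e1_herm -mulrA ringinv_corner_comm mulrA.
by rewrite theta1_mull.
Qed.

Lemma corner_inv_mull : corner_inv * compression = e1.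
Proof.
have [ggi gig] := ringinvP corner_invertible.
rewrite -corner_theta1 /corner_inv -mulrA (mulrA (ringinv _)) gig mul1r.
exact: theta1_mull.
Qed.

Lemma corner_inv_mulr : compression * corner_inv = e1.
Proof.
have [ggi gig] := ringinvP corner_invertible.
rewrite -corner_theta1 -mulrA (mulrA e1 e1) theta1_mull mulrA corner_comm.
by rewrite -mulrA ggi mulr1.
Qed.

Lemma corner_inv_theta1 : corner_inv * e1 = corner_inv.
Proof. by rewrite /corner_inv -mulrA ringinv_corner_comm mulrA theta1_mull. Qed.

(** * The adjacency operator *)

Local Notation s := (posroot (@vpos C M) 2 corner_inv).

Lemma root_vpos : vpos s.
Proof. by have [] := posrootP (isT : (0 < 2)%N) corner_inv_vpos. Qed.

Lemma root_sqr : s * s = corner_inv.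
Proof. by rewrite -expr2; have [] := posrootP (isT : (0 < 2)%N) corner_inv_vpos. Qed.

Lemma root_comm x : s * theta x = theta x * s.
Proof.
apply: (@vpos_pow_comm _ _ _ _ 2) => //; first exact: root_vpos.
by rewrite expr2 root_sqr corner_inv_comm.
Qed.

(** This identity makes the adjacency operator Schur idempotent. *)
Lemma root_compression : s * compression * s = e1.
Proof.
rewrite (@vpos_pow_comm _ _ s compression 2) //; last 1 first.
- by rewrite expr2 root_sqr corner_inv_mull corner_inv_mulr.
- by rewrite -mulrA root_sqr corner_inv_mulr.
exact: root_vpos.
Qed.

(** The operator A of the introduction, with the roots of the densities as
parameters. *)
Definition adjacency_op : 'Hom(elt N, elt M) :=
  linfun (fun x : elt N => q * s * theta (r * x * r) * s * q).

Lemma adjacency_opE x : adjacency_op x = q * s * theta (r * x * r) * s * q.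
Proof.
rewrite /adjacency_op linfunE // => c u v.
rewrite mulrDr mulrDl linearD !mulrDr !mulrDl -vscaleAr -vscaleAl linearZ /=.
by rewrite -vscaleAr -!vscaleAl.
Qed.

Lemma adjacency_op_cp : vstar r = r -> completely_positive adjacency_op.
Proof.
move=> r_herm k x x_pos.
have s_herm := vpos_herm root_vpos.
have := ampl_pos_conj (s * q) (star_hom_cp D theta_hom (ampl_pos_conj r x_pos)).
congr ampl_pos; apply/funext => i; apply/funext => j.
by rewrite adjacency_opE vstarM q_herm s_herm r_herm !mulrA.
Qed.

Lemma adjacency_op_schur (phiN : {scalar elt N}) QN :
  faithful_positive phiN -> is_density phiN QN -> ringinv QN = ri ^+ 4 ->
  schur phiN adjacency_op adjacency_op = adjacency_op.
Proof.
move=> phiN_fp QN_density QNi; apply/lfunP => x.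
rewrite (schurE D phiN_fp QN_density) QNi.
pose f (u v : elt N) := adjacency_op (x * u) * adjacency_op (ri ^+ 2 * v).
have f_linl v : linear (f^~ v).
  by move=> c u u'; rewrite /f mulrDr linearD -vscaleAr linearZ mulrDl vscaleAl.
have f_linr u : linear (f u).
  by move=> c v v'; rewrite /f mulrDr linearD -vscaleAr linearZ mulrDr vscaleAr.
transitivity (\sum_(al : blk D) (bsize al)%:R^-1 *:
    \sum_i \sum_j q * s * theta (r * x) * s *
      (sandwich (munit i j) (munit (al := al) j i)) * (s * theta r * s * q)).
  apply: eq_bigr => al _; congr (_ *: _).
  (* Q_N^-1 = ri^4 is shared between the two factors. *)
  transitivity (\sum_i \sum_j f (munit i j * ri ^+ 2) (munit (al := al) j i)).
    rewrite (casimir_inner _ f_linl f_linr).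
    apply: eq_bigr => i _; apply: eq_bigr => j _.
    by rewrite /f (mulrA (ri ^+ 2)) -exprD.
  apply: eq_bigr => i _; apply: eq_bigr => j _.
  rewrite /f !adjacency_opE /sandwich.
  have -> : r * (x * (munit i j * ri ^+ 2)) * r = r * x * (munit i j * ri).
    by rewrite expr2 -!mulrA rir mulr1.
  have -> : r * (ri ^+ 2 * munit j i) * r = ri * munit j i * r.
    by rewrite expr2 !mulrA rri mul1r.
  rewrite (star_homM (r * x)) (star_homM _ r) !mulrA.
  rewrite -(mulrA _ (theta (munit i j * ri)) s) -root_comm !mulrA.
  by rewrite -(mulrA _ s (theta (ri * munit j i))) root_comm !mulrA.
rewrite -sum_scale_mulr -sum_scale_mull adjacency_opE (star_homM _ r).
rewrite -/compression -!mulrA; congr (q * (s * _)); rewrite !mulrA.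
rewrite -(mulrA _ s compression) -(mulrA _ (s * compression)) root_compression.
by rewrite theta1_mulr.
Qed.

End CornerInverse.

(** * The bimodule generated by the adjacency operator *)

(** Taking adjoints turns y v = v theta(y) into T y = theta(y) T. Evaluating at 1
shows that these T are the maps y |-> theta(y) z. *)
Lemma intertwiners_adjE (C : numClosedFieldType) (N M : vNalg C)
    (phiN : {scalar elt N}) (phiM : {scalar elt M}) (theta : 'Hom(elt N, elt M)) :
  faithful_positive phiN -> faithful_positive phiM -> star_hom theta ->
  intertwiners_adj phiN phiM theta =
  [set T | forall y x, T (y * x) = theta y * T x]%classic.
Proof.
move=> phiN_fp phiM_fp [thM thS].
have ipN := gns_inner phiN_fp; have ipM := gns_inner phiM_fp.
have [sesN _ _] := ipN; have [sesM _ _] := ipM.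
have ndN := inner_product_nondeg ipN; have ndM := inner_product_nondeg ipM.
apply/seteqP; split=> [_ [v v_int <-] y x|T T_int] /=.
  have adj := adjointP v ipM sesN.
  apply: (nondegenerate_inj sesM ndM) => z.
  rewrite -adj -[y in LHS]vstarK -gns_mul.
  have -> : vstar y * v z = v (theta (vstar y) * z).
    have /lfunP/(_ z) := v_int (vstar y).
    by rewrite !comp_lfunE !lmulE.
  by rewrite adj gns_mul -thS vstarK.
have adj := adjointP T ipN sesM.
exists (adjoint (gns phiN) (gns phiM) T).
  move=> y; apply/lfunP => x; rewrite !comp_lfunE !lmulE.
  apply: (nondegenerate_inj sesN ndN) => z.
  rewrite -adj -[y in LHS]vstarK -gns_mul -adj T_int gns_mul -thS vstarK.
  by [].
apply: adjoint_eq => // x y.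
by rewrite (inner_product_herm ipN) -adj -(inner_product_herm ipM).
Qed.

Lemma modularVE (C : numClosedFieldType) (M : vNalg C) (a x : elt M) :
  invertible a -> (modular a)^-1%VF x = ringinv a * x * a.
Proof.
move=> a_inv; have [aai aia] := ringinvP a_inv.
have ker0 : (lker (modular a) == 0)%VS.
  apply/lker0P => y z; rewrite !modularE => /(congr1 (fun w => ringinv a * w * a)).
  by rewrite !mulrA aia !mul1r -!mulrA aia !mulr1.
rewrite -[RHS](lker0_lfunK ker0) modularE; congr (_ _).
by rewrite !mulrA aai mul1r -mulrA aai mulr1.
Qed.

Lemma commutant_mull (C : numClosedFieldType) (M : vNalg C) (T : 'End(elt M))
    (x y : elt M) :
  commutant T -> T (x * y) = x * T y.
Proof. by move=> /(_ x)/lfunP/(_ y); rewrite !comp_lfunE !lmulE. Qed.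

Section Bimodule.
Variables (C : numClosedFieldType) (N M : vNalg C) (D : blocks N).
Variables (phiM : {scalar elt M}) (phiM_fp : faithful_positive phiM).
Variables (phiN : {scalar elt N}) (phiN_fp : faithful_positive phiN).
Variables (theta : 'Hom(elt N, elt M)) (theta_hom : star_hom theta).
Variables (h : elt M) (r : elt N).
Hypotheses (h_pos : vpos h) (h_inv : invertible h).
Hypotheses (r_pos : vpos r) (r_inv : invertible r).
Let q := ringinv h.
Let ri := ringinv r.
Let a := compression D theta q ri.
Let u := corner_inv D theta q ri.

(** The right multiplication by m below is the element of M' that recovers T from
the twisted adjacency operator. *)
Lemma adjacency_bimodule :
  bimodule (modular h \o adjacency_op D theta q r ri \o (modular r)^-1)%VF =
  intertwiners_adj phiN phiM theta.
Proof.
have [hq qh] := ringinvP h_inv; have [rri rir] := ringinvP r_inv.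
rewrite -/q in hq qh; rewrite -/ri in rri rir.
have q_pos : vpos q by apply: vpos_ringinv.
have q_herm := vpos_herm q_pos.
have q_inv : invertible q by exists h.
have ri_herm : vstar ri = ri by apply/vpos_herm/vpos_ringinv.
have thM := star_homM theta_hom.
have rcomm := root_comm D phiM_fp theta_hom q_herm q_inv ri_herm rri.
have rsqr := root_sqr D phiM_fp theta_hom q_herm q_inv ri_herm rri.
set X := (_ \o _ \o _)%VF.
have XE y : X y = theta y * (u * theta (r ^+ 2) * q ^+ 2).
  rewrite /X !comp_lfunE modularVE // modularE adjacency_opE -/q -/ri.
  rewrite /u -[X in theta y * (X * _ * _)]rsqr.
  move: (posroot _ _ _) rcomm => s s_comm.
  rewrite !mulrA hq mul1r rri mul1r s_comm -(mulrA y) thM.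
  rewrite -(mulrA (theta y)) -(s_comm (r * r)) !mulrA.
  by rewrite -(mulrA (theta y * s)) -(s_comm (r * r)) !mulrA.
move: X XE => X XE.
rewrite intertwiners_adjE //; apply/seteqP.
split=> [T [n [c [w [w_X ->]]]] y x|T T_int] /=.
  rewrite !sum_lfunE mulr_sumr; apply: eq_bigr => i _.
  rewrite !scale_lfunE -vscaleAr; congr (_ *: _).
  have [a' [b [a_comm b_comm ->]]] := w_X i.
  rewrite !comp_lfunE.
  rewrite (commutant_mull _ _ b_comm).
  by rewrite -(commutant_mull _ _ a_comm) !XE thM !mulrA.
pose m := h ^+ 2 * theta (ri ^+ 2) * a * T 1.
pose R := linfun (fun x : elt M => x * m).
have RE x : R x = x * m.
  by rewrite /R linfunE // => c x' y'; rewrite mulrDl vscaleAl.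
exists 1%N, (fun=> 1), (fun=> T); split=> [_|]; last by rewrite big_ord1 scale1r.
exists R, \1%VF; split.
- by move=> x; apply/lfunP => y; rewrite !comp_lfunE !lmulE !RE mulrA.
- by move=> x; apply/lfunP => y; rewrite !comp_lfunE !id_lfunE.
apply/lfunP => y; rewrite !comp_lfunE id_lfunE RE.
rewrite XE /m.
have -> : T y = theta y * T 1 by rewrite -T_int mulr1.
have uK : u * theta 1 * a = theta 1.
  rewrite /u (corner_inv_theta1 D phiM_fp theta_hom q_herm q_inv ri_herm rri).
  exact: (corner_inv_mull D phiM_fp theta_hom q_herm q_inv ri_herm rri).
have uE : u * theta (r ^+ 2) * q ^+ 2 * (h ^+ 2 * theta (ri ^+ 2) * a) = theta 1.
  rewrite -[RHS]uK; move: (u) (a) => u' a'.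
  have q2h2 : q ^+ 2 * h ^+ 2 = 1.
    by rewrite !expr2 !mulrA -(mulrA q) qh mulr1 qh.
  have r2ri2 : r ^+ 2 * ri ^+ 2 = 1.
    by rewrite !expr2 !mulrA -(mulrA r) rri mulr1 rri.
  rewrite -(mulrA _ (q ^+ 2)) -(mulrA (h ^+ 2)) (mulrA (q ^+ 2)) q2h2 mul1r.
  by rewrite [LHS]mulrA -(mulrA u' (theta (r ^+ 2))) -thM r2ri2.
rewrite -(mulrA (theta y)) (mulrA (u * _ * _)) uE (mulrA (theta y)).
by rewrite -thM mulr1.
Qed.

End Bimodule.

(** * Partial traces *)

Section TensorMatrices.
Variable C : numClosedFieldType.

Lemma tensmx_suml m n p q (I : finType) (A : I -> 'M[C]_(m, n)) (B : 'M[C]_(p, q)) :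
  (\sum_i A i) *t B = \sum_i (A i *t B).
Proof.
apply/matrixP => x y; rewrite summxE !mxE summxE mulr_suml.
by apply: eq_bigr => i _; rewrite mxE.
Qed.

Lemma tensmx_sumr m n p q (I : finType) (A : 'M[C]_(m, n)) (B : I -> 'M[C]_(p, q)) :
  A *t (\sum_i B i) = \sum_i (A *t B i).
Proof.
apply/matrixP => x y; rewrite summxE !mxE summxE mulr_sumr.
by apply: eq_bigr => i _; rewrite mxE.
Qed.

Lemma tensmxZl m n p q c (A : 'M[C]_(m, n)) (B : 'M[C]_(p, q)) :
  (c *: A) *t B = c *: (A *t B).
Proof. by apply/matrixP => x y; rewrite !mxE mulrA. Qed.

Lemma tensmxZr m n p q c (A : 'M[C]_(m, n)) (B : 'M[C]_(p, q)) :
  A *t (c *: B) = c *: (A *t B).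
Proof. by apply/matrixP => x y; rewrite !mxE mulrCA. Qed.

Lemma tensmx11 n k : (1%:M : 'M[C]_n) *t (1%:M : 'M[C]_k) = 1%:M.
Proof.
apply/matrixP => x y.
case: (mxtens_indexP x) => i j; case: (mxtens_indexP y) => a b.
rewrite tensmxE !mxE (can_eq (@mxtens_indexK n k)) xpair_eqE.
by case: (i == a); case: (j == b); rewrite ?(mulr1, mulr0).
Qed.

Lemma sum_mxtens n k (F : 'I_(n * k) -> C) :
  \sum_m F m = \sum_i \sum_j F (mxtens_index (i, j)).
Proof.
rewrite pair_bigA /= (reindex (@mxtens_index n k)) /=; last first.
  by exists (@mxtens_unindex n k) => x _; rewrite (mxtens_indexK, mxtens_unindexK).
by apply: eq_bigr => -[].
Qed.

(** The coefficient of e_ii (x) t_ab is sum_j A_ja A_bj. *)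
Lemma tens_partial_trace n k (A : 'M[C]_n) (t : 'I_n -> 'I_n -> 'M[C]_k) :
  \sum_(i < n) \sum_(j < n) ((delta_mx i j *m A) *t (1%:M : 'M_k)) *m
      (\sum_a \sum_b (delta_mx a b *t t a b)) *m
      ((A *m delta_mx j i) *t (1%:M : 'M_k)) =
  (1%:M : 'M_n) *t (\sum_a \sum_b (A *m A) b a *: t a b).
Proof.
transitivity (\sum_(i < n) \sum_(j < n) \sum_(a < n) \sum_(b < n)
    (A j a * A b j) *: ((delta_mx i i : 'M_n) *t t a b)).
  apply: eq_bigr => i _; apply: eq_bigr => j _.
  rewrite mulmx_sumr mulmx_suml; apply: eq_bigr => a _.
  rewrite mulmx_sumr mulmx_suml; apply: eq_bigr => b _.
  rewrite !tensmx_mul mul1mx mulmx1 delta_mx_sandwich -scalemxAl mulmxA.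
  by rewrite delta_mx_sandwich scalerA tensmxZl.
have -> : (1%:M : 'M[C]_n) = \sum_i delta_mx i i.
  by rewrite scalar_mx_sum_delta; apply: eq_bigr => i _; rewrite scale1r.
rewrite tensmx_suml; apply: eq_bigr => i _.
rewrite tensmx_sumr exchange_big; apply: eq_bigr => a _.
rewrite tensmx_sumr exchange_big; apply: eq_bigr => b _ /=.
rewrite tensmxZr mxE -scaler_suml; congr (_ *: _).
by apply: eq_bigr => j _; rewrite mulrC.
Qed.

(** The vector e_o (x) xi. *)
Definition tens_embed n k (o : 'I_n) (xi : 'cV[C]_k) : 'cV[C]_(n * k) :=
  \col_m ((o == (mxtens_unindex m).1)%:R * xi (mxtens_unindex m).2 0).

Lemma tens_embedE n k (o : 'I_n) (xi : 'cV[C]_k) i j z :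
  tens_embed o xi (mxtens_index (i, j)) z = (o == i)%:R * xi j 0.
Proof. by rewrite mxE mxtens_indexK. Qed.

Lemma tens_embed_mul n k (o : 'I_n) (A : 'M[C]_k) xi :
  ((1%:M : 'M_n) *t A) *m tens_embed o xi = tens_embed o (A *m xi).
Proof.
apply/colP => m; case: (mxtens_indexP m) => i j.
rewrite tens_embedE !mxE sum_mxtens (bigD1 i) //= [X in _ + X]big1 ?addr0.
  rewrite mulr_sumr; apply: eq_bigr => l _.
  by rewrite tensmxE tens_embedE mxE eqxx mulr1n mul1r mulrCA.
move=> a ne; rewrite big1 // => l _; rewrite tensmxE mxE eq_sym (negPf ne).
by rewrite !mul0r.
Qed.

Lemma dotcv_tens_embed n k (o : 'I_n) (xi eta : 'cV[C]_k) :
  dotcv (tens_embed o xi) (tens_embed o eta) = dotcv xi eta.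
Proof.
rewrite !dotcvE sum_mxtens (bigD1 o) //= [X in _ + X]big1 ?addr0.
  by apply: eq_bigr => l _; rewrite !tens_embedE eqxx !mul1r.
move=> a ne; rewrite big1 // => l _; rewrite !tens_embedE eq_sym (negPf ne).
by rewrite !mul0r mulr0.
Qed.

End TensorMatrices.

(** * The restriction to the range of theta(1_alpha) *)

Section Identification.
Variables (C : numClosedFieldType) (N M : vNalg C) (D : blocks N).
Variables (phi : {scalar elt M}) (phi_fp : faithful_positive phi).
Variables (theta : 'Hom(elt N, elt M)) (theta_hom : star_hom theta).
Variables (q : elt M) (r ri : elt N).
Hypotheses (q_herm : vstar q = q) (q_inv : invertible q).
Hypotheses (ri_herm : vstar ri = ri) (rri : r * ri = 1) (rir : ri * r = 1).
Variables (al : blk D) (k : nat) (W : 'Hom('cV[C]_(bsize al * k), elt M)).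
Hypothesis W_id : is_identification phi theta W.
Variable t : 'I_(bsize al) -> 'I_(bsize al) -> 'M[C]_k.
Hypothesis t_def : forall xi,
  theta (bunit al) * q ^+ 2 * theta (bunit al) * W xi =
  W ((\sum_i \sum_j (delta_mx i j *t t i j)) *m xi).

(** The operator v_alpha. *)
Definition partial_trace : 'M[C]_k :=
  \sum_i \sum_j (bproj al ri *m bproj al ri) j i *: t i j.
Local Notation v := partial_trace.
Local Notation a := (compression D theta q ri).

Local Notation n := (bsize al).

Lemma range_bunit xi : theta (bunit al) * W xi = W xi.
Proof.
have [_ imW _] := W_id; have : W xi \in limg W by rewrite memv_img ?memvf.
rewrite imW => /memv_imgP[z _ ->]; rewrite lmulE mulrA -(star_homM theta_hom).
by rewrite /bunit bincl_mulr mul1mx bproj_bincl.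
Qed.

Lemma range_theta y xi : theta y * W xi = W ((bproj al y *t (1%:M : 'M_k)) *m xi).
Proof.
have [_ _ <-] := W_id; rewrite -[in LHS]range_bunit mulrA -(star_homM theta_hom).
by rewrite /bunit bincl_mull mulmx1.
Qed.

Lemma range_theta1 xi : theta 1 * W xi = W xi.
Proof. by rewrite range_theta bproj1 tensmx11 mul1mx. Qed.

Lemma range_inj xi : W xi = 0 -> xi = 0.
Proof.
have [W_iso _ _] := W_id; move=> W0; apply: dotcv_eq0; rewrite -W_iso W0.
by rewrite /gns mulr0 linear0.
Qed.

(** The factor theta(1_be) of the summands kills the range of theta(1_al) for be
different from al; for be = al this is [tens_partial_trace]. *)
Lemma range_compression xi : a * W xi = n%:R^-1 *: W (((1%:M : 'M_n) *t v) *m xi).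
Proof.
rewrite sum_scale_mulr (bigD1 al) //= [X in _ + X]big1 ?addr0 => [|be ne]; last first.
  rewrite big1 ?scaler0 // => i _; rewrite big1 // => j _.
  rewrite /sandwich -mulrA range_theta bprojM bproj_bincl_ne 1?eq_sym //.
  by rewrite mulmx0 tens0mx mul0mx linear0 mulr0.
congr (_ *: _); rewrite /v -tens_partial_trace mulmx_suml linear_sum.
apply: eq_bigr => i _; rewrite mulmx_suml linear_sum; apply: eq_bigr => j _.
rewrite /sandwich -mulrA range_theta -range_bunit.
have -> : theta (munit i j * ri) = theta (munit i j * ri) * theta (bunit al).
  by rewrite -(star_homM theta_hom) /bunit bincl_mull mulmx1 bprojM bproj_bincl
    /munit bincl_mulr.
have t_def' zeta : theta (bunit al) * (q ^+ 2 * (theta (bunit al) * W zeta)) =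
    W ((\sum_i \sum_j (delta_mx i j *t t i j)) *m zeta) by rewrite -t_def !mulrA.
rewrite -2!mulrA t_def'.
by rewrite range_theta !bprojM !bproj_bincl !mulmxA.
Qed.

(** The quadratic form of v is that of a on the vectors W (e_o (x) xi). *)
Lemma partial_trace_gns xi (o : 'I_n) (x := W (tens_embed o xi)) :
  dotcv xi (v *m xi) = n%:R * gns phi x (a * x).
Proof.
have n_neq0 : n%:R != 0 :> C by rewrite pnatr_eq0 -lt0n bsize_gt0.
have [W_iso _ _] := W_id; have [[_ _ _ gZr] _ _] := gns_inner phi_fp.
rewrite range_compression gZr mulrA mulfV // mul1r W_iso tens_embed_mul.
by rewrite dotcv_tens_embed.
Qed.

Lemma partial_trace_psd : psdmx v.
Proof.
move=> xi; rewrite (partial_trace_gns xi (Ordinal (bsize_gt0 al))) mulr_ge0 ?ler0n //.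
rewrite /gns mulrA; apply: (functional_vpos phi_fp _).1; apply: vpos_conj.
exact: compression_vpos.
Qed.

Lemma partial_trace_unit : v \in unitmx.
Proof.
apply: injective_unitmx => xi vxi0; pose o := Ordinal (bsize_gt0 al).
suff e0 : tens_embed o xi = 0.
  apply: dotcv_eq0; rewrite -(dotcv_tens_embed o) e0 dotcvE big1 // => i _.
  by rewrite !mxE mulr0.
apply: range_inj; rewrite -range_theta1.
apply: (compression_eq0 (D := D) phi_fp theta_hom q_herm q_inv ri_herm rri).
rewrite range_compression tens_embed_mul vxi0.
have -> : tens_embed o 0 = 0 :> 'cV[C]_(n * k).
  by apply/colP => m; rewrite !mxE mulr0.
by rewrite linear0 scaler0.
Qed.

Local Notation u := (corner_inv D theta q ri).

Lemma range_corner_inv xi :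
  u * W xi = W (((1%:M : 'M_n) *t (n%:R *: invmx v)) *m xi).
Proof.
have n_neq0 : n%:R != 0 :> C by rewrite pnatr_eq0 -lt0n bsize_gt0.
set zeta := _ *m xi.
have cWz : corner D theta q ri * W zeta = W xi.
  rewrite mulrDl mulrBl mul1r range_theta1 subrr addr0 range_compression.
  rewrite mulmxA tensmx_mul mulmx1 -scalemxAr mulmxV ?partial_trace_unit //.
  by rewrite tensmxZr tensmx11 -scalemxAl mul1mx linearZ /= scalerA mulVf // scale1r.
have [_ gig] :=
  ringinvP (corner_invertible D phi_fp theta_hom q_herm q_inv ri_herm rri).
by rewrite /corner_inv -mulrA -cWz (mulrA (ringinv _)) gig mul1r range_theta1.
Qed.

Lemma range_block_term y :
  theta (bunit al) * on_range W (n%:R *: invmx v) (theta (bunit al) * y) =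
  u * (theta (bunit al) * y).
Proof.
have [_ imW _] := W_id.
have : theta (bunit al) * y \in limg W by rewrite imW -lmulE memv_img ?memvf.
move=> /memv_imgP[xi _ ->].
rewrite range_corner_inv /on_range !comp_lfunE lker0_lfunK; last first.
  apply/lker0P => x z /eqP; rewrite -subr_eq0 -linearB => /eqP/range_inj/eqP.
  by rewrite subr_eq0 => /eqP.
rewrite linfunE ?range_bunit // => c x z.
by rewrite mulmxDr scalemxAr.
Qed.

End Identification.

Theorem mainTheorem8 (R : realType) (M N : vNalg R[i])
  (phiM : {scalar elt M}) (phiN : {scalar elt N})
  (phiM_fp : faithful_positive phiM) (phiN_fp : faithful_positive phiN)
  (QM : elt M) (QN : elt N)
  (QM_density : is_density phiM QM) (QN_density : is_density phiN QN)
  (theta : 'Hom(elt N, elt M)) (theta_hom : star_hom theta)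
  (D : blocks N) (k : blk D -> nat)
  (W : forall al : blk D, 'Hom('cV[R[i]]_(bsize al * k al), elt M))
  (W_id : forall al, is_identification phiM theta (W al))
  (t : forall al : blk D,
     'I_(bsize al) -> 'I_(bsize al) -> 'M[R[i]]_(k al))
  (t_def : forall al xi,
     theta (bunit al) * ringinv (posroot (@vpos _ M) 2 QM) * theta (bunit al)
       * W al xi =
     W al ((\sum_i \sum_j (delta_mx i j *t t al i j)) *m xi)) :
  let v (al : blk D) : 'M[R[i]]_(k al) :=
    \sum_i \sum_j
      invmx (posroot (@psdmx _ _) 2 (bproj al QN)) j i *: t al i j in
  (* The factor n(alpha) is forced by the Markov trace normalisation: with
     N = M = M_n, theta = id and phi = Tr_M one has m m^* = 1 and v = n. *)
  let ua (al : blk D) : 'M[R[i]]_(k al) :=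
    (bsize al)%:R *: invmx (v al) in
  let nablaM_quarter := oproot (gns phiM) 4 (modular QM) in
  let nablaN_quarter := oproot (gns phiN) 4 (modular QN) in
  [/\ forall al, psdmx (v al) /\ v al \in unitmx,
      forall al, exists a : elt M,
        forall xi, a * W al xi = W al ((1%:M *t v al) *m xi) &
      exists2 u : elt M, lmul u = block_operator theta W ua &
        [/\ vpos u,
            forall y : elt N,
              (lmul u \o lmul (theta y))%VF = (lmul (theta y) \o lmul u)%VF,
            forall al, ua al \in unitmx /\
              forall xi, u * W al xi = W al ((1%:M *t ua al) *m xi) &
            let A := adjacency QN QM theta u in
            [/\ completely_positive A,
                schur phiN A A = A &
                bimodule (nablaM_quarter \o A \o nablaN_quarter^-1)%VF =
                  intertwiners_adj phiN phiM theta]]].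
Proof.
move=> v ua nablaM_quarter nablaN_quarter.
have [QM_pos QM_inv _] := QM_density; have [QN_pos QN_inv _] := QN_density.
have [h_pos hQ] := posrootP (isT : (0 < 4)%N) QM_pos.
have [r_pos rQ] := posrootP (isT : (0 < 4)%N) QN_pos.
have nablaME := oproot_modular phiM_fp QM_density.
have nablaNE := oproot_modular phiN_fp QN_density.
rewrite -/nablaM_quarter in nablaME; rewrite -/nablaN_quarter in nablaNE.
have adjE u : adjacency QN QM theta u = linfun (fun x : elt N =>
  ringinv (posroot (@vpos R[i] M) 4 QM) * posroot (@vpos R[i] M) 2 u *
  theta (posroot (@vpos R[i] N) 4 QN * x * posroot (@vpos R[i] N) 4 QN) *
  posroot (@vpos R[i] M) 2 u * ringinv (posroot (@vpos R[i] M) 4 QM)) by [].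
move: (posroot _ 4 QM) (posroot _ 4 QN) => h r
  in h_pos hQ r_pos rQ nablaME nablaNE adjE *.
have h_inv : invertible h by apply: (@invertible_root _ h 3); rewrite hQ.
have r_inv : invertible r by apply: (@invertible_root _ r 3); rewrite rQ.
have [hq qh] := ringinvP h_inv; have [rri rir] := ringinvP r_inv.
have q_pos := vpos_ringinv h_pos h_inv; have ri_pos := vpos_ringinv r_pos r_inv.
have q_herm := vpos_herm q_pos; have ri_herm := vpos_herm ri_pos.
have q_inv := invertible_ringinv h_inv.
have QM_root := ringinv_posroot_half (isT : (0 < 2)%N) h_pos h_inv hQ.
have QN_root al := invmx_posroot_bproj al r_pos r_inv rQ.
have vE al : v al = partial_trace (ringinv r) (t al).
  by rewrite /v /partial_trace -QN_root.
have t_def' al xi :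
    theta (bunit al) * ringinv h ^+ 2 * theta (bunit al) * W al xi =
    W al ((\sum_i \sum_j (delta_mx i j *t t al i j)) *m xi).
  by rewrite -QM_root t_def.
have n_neq0 (al : blk D) : (bsize al)%:R != 0 :> R[i].
  by rewrite pnatr_eq0 -lt0n bsize_gt0.
have v_unit al : v al \in unitmx.
  by rewrite vE; apply: (partial_trace_unit phiM_fp theta_hom q_herm q_inv ri_herm
    rri (W_id al) (@t_def' al)).
have uaE al : ua al = (bsize al)%:R *: invmx (partial_trace (ringinv r) (t al)).
  by rewrite /ua vE.
split=> [al|al|].
- split=> //; rewrite vE.
  exact: (partial_trace_psd phiM_fp theta_hom q_herm ri_herm (W_id al)
    (@t_def' al)).
- exists ((bsize al)%:R *: compression D theta (ringinv h) (ringinv r)) => xi.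
  rewrite -vscaleAl.
  rewrite (range_compression theta_hom (ringinv r) (W_id al) (@t_def' al)).
  by rewrite scalerA mulfV // scale1r vE.
have u_range al xi : corner_inv D theta (ringinv h) (ringinv r) * W al xi =
    W al (((1%:M : 'M_(bsize al)) *t ua al) *m xi).
  by rewrite uaE; apply: (range_corner_inv phiM_fp theta_hom q_herm q_inv ri_herm
    rri (W_id al) (@t_def' al)).
exists (corner_inv D theta (ringinv h) (ringinv r)).
  apply/lfunP => y; rewrite lmulE /block_operator sum_lfunE.
  rewrite -(corner_inv_theta1 D phiM_fp theta_hom q_herm q_inv ri_herm rri).
  rewrite -mulrA -(bunit_sum D) linear_sum mulr_suml mulr_sumr.
  apply: eq_bigr => al _; rewrite /= 2!comp_lfunE !lmulE uaE.
  by rewrite (range_block_term phiM_fp theta_hom q_herm q_inv ri_herm rri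
    (W_id al) (@t_def' al)).
split.
- exact: (corner_inv_vpos D phiM_fp theta_hom q_herm q_inv ri_herm rri).
- move=> y; rewrite -!lmulM.
  by rewrite (corner_inv_comm D phiM_fp theta_hom q_herm q_inv ri_herm rri).
- move=> al; split; last exact: u_range.
  by rewrite /ua unitmxZ ?unitfE // unitmx_inv.
have -> : adjacency QN QM theta (corner_inv D theta (ringinv h) (ringinv r)) =
    adjacency_op D theta (ringinv h) r (ringinv r) by exact: adjE.
rewrite nablaME nablaNE; split.
- exact: (adjacency_op_cp D phiM_fp theta_hom q_herm q_inv ri_herm rri
    (vpos_herm r_pos)).
- apply: (adjacency_op_schur D phiM_fp theta_hom q_herm q_inv ri_herm rri rir
    phiN_fp QN_density).
  by rewrite -rQ ringinvX.
- exact: (adjacency_bimodule D phiM_fp phiN_fp theta_hom).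
Qed.
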